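(* Let $\nu(\mathrm dy)=\frac{a(y)}{|y|^{d+1}}\mathrm dy$, where $a$ is a measurable function on $\mathbb R^d$ with $c_1\le a(y)\le c_2$ for constants $0<c_1\le c_2$, and $\int_{r\le|y|\le R}\frac{y\,a(y)}{|y|^{d+1}}\mathrm dy=0$ for all $0<r<R<+\infty$. Assume that $b\in L^\infty([0,1];C^\infty_b(\mathbb R^d;\mathbb R^d))$ and $f\in L^\infty([0,1];C^\infty_b(\mathbb R^d))$. For given $\varphi\in C^\infty_b(\mathbb R^d)$, let $u\in C([0,1];C^\infty_b(\mathbb R^d))$ satisfy, for all $(t,x)\in[0,1]\times\mathbb R^d$, $$u(t,x)=\varphi(x)+\int_0^t\mathcal L^\nu u(s,x)\,\mathrm ds+\int_0^tb(s,x)\cdot\nabla u(s,x)\,\mathrm ds+\int_0^tf(s,x)\,\mathrm ds.$$ Then for any $\gamma\in(0,1)$ there exist a $\beta\in(0,1)$ and a constant $C$, depending only on $d,c_1,\gamma$ and $\|b\|_\infty$, such that $$\sup_{t\in[0,1]}\|u(t)\|_{\mathcal H^\beta}\le C\big(\|f\|_\infty+\|\varphi\|_\infty+\|\varphi\|_{\mathcal H^\gamma}\big).$$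
   Context: $C^\infty_b$ denotes bounded smooth functions with bounded derivatives of all orders. The Lévy operator is $$\mathcal L^\nu g(x):=\int_{\mathbb R^d}[g(x+y)-g(x)-1_{|y|\le1}\,y\cdot\nabla g(x)]\,\nu(\mathrm dy).$$ For $\beta\in(0,1)$, $\|g\|_{\mathcal H^\beta}:=\sup_{x\neq y,\,|x-y|\le1}|g(x)-g(y)|/|x-y|^\beta$. $\|b\|_\infty$ and $\|f\|_\infty$ are the supremum norms on $[0,1]\times\mathbb R^d$. *)

(* Defs.v *)
From HB Require Import structures.
From mathcomp Require Import all_boot all_order all_algebra.
From mathcomp Require Import all_classical all_reals all_analysis.

Set Implicit Arguments.
Unset Strict Implicit.
Unset Printing Implicit Defensive.

Import Order.TTheory GRing.Theory Num.Theory.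
Import numFieldNormedType.Exports.

Local Open Scope classical_set_scope.
Local Open Scope ring_scope.

(* Measurable structure on R^n: the sigma-algebra generated by the coordinates,
   as the library does for n.-tuple T. For T = R it is the Borel sigma-algebra. *)

Definition measure_rV_display : measure_display -> measure_display.
Proof. exact. Qed.

Section measurable_rV.
Context {disp} {T : measurableType disp}.
Variable n : nat.

Let coors : 'I_n -> 'rV[T]_n -> T := fun i x => x ord0 i.

Let rV_set0 : g_sigma_preimage coors set0.
Proof. exact: sigma_algebra0. Qed.

Let rV_setC A : g_sigma_preimage coors A -> g_sigma_preimage coors (~` A).
Proof. exact: sigma_algebraC. Qed.

Let rV_bigcup (F : _^nat) : (forall i, g_sigma_preimage coors (F i)) ->
  g_sigma_preimage coors (\bigcup_i (F i)).
Proof. exact: sigma_algebra_bigcup. Qed.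

HB.instance Definition _ := @isMeasurable.Build (measure_rV_display disp)
  'rV[T]_n (g_sigma_preimage coors) rV_set0 rV_setC rV_bigcup.

End measurable_rV.

Lemma measurable_coord {disp} {T : measurableType disp} n (i : 'I_n) :
  measurable_fun [set: 'rV[T]_n] (fun x => x ord0 i).
Proof.
move=> _ Y mY; rewrite setTI; apply: sub_sigma_algebra => /=.
rewrite -bigcup_seq/=; exists i => /=; first by rewrite mem_index_enum.
by exists Y => //; rewrite setTI.
Qed.

Lemma measurable_fun_rV {d1 d2} {T1 : measurableType d1}
    {T2 : measurableType d2} n (f : T1 -> 'rV[T2]_n) :
  (forall i, measurable_fun [set: T1] (fun t => f t ord0 i)) ->
  measurable_fun [set: T1] f.
Proof.
move=> mf _ Y mY.
suff : g_sigma_preimage (fun (i : 'I_n) (x : 'rV[T2]_n) => x ord0 i) `<=`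
    [set A | measurable (f @^-1` A)].
  by rewrite setTI; exact.
apply: smallest_sub.
  split=> [/=|A /= mA|F /= mF].
  - by rewrite preimage_set0.
  - by rewrite setTD preimage_setC; exact: measurableC.
  - by rewrite preimage_bigcup; exact: bigcupT_measurable.
rewrite -bigcup_seq => A [i _] [B mB <-] /=.
by rewrite setTI -[X in measurable X]setTI; exact: mf.
Qed.

Section lebesgue_rV.
Context {R : realType}.

Definition rV_cons n (p : measurableTypeR R * 'rV[R]_n) : 'rV[R]_n.+1 :=
  row_mx (const_mx p.1 : 'rV_1) p.2.

(* R^(n+1) is identified with R * R^n; R^0 is a point. *)
Fixpoint lebesgue_rV n : set 'rV[R]_n -> \bar R :=
  if n is m.+1 then
    pushforward (lebesgue_measure \x @lebesgue_rV m)%E (@rV_cons m)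
  else \d_(0 : 'rV[R]_0).

Let rV_uncons n (x : 'rV[R]_n.+1) : measurableTypeR R * 'rV[R]_n :=
  (x ord0 ord0, rsubmx (x : 'rV_(1 + n))).

Let rV_consK n : cancel (@rV_cons n) (@rV_uncons n).
Proof.
move=> [r x]; rewrite /rV_uncons /rV_cons row_mxKr; congr pair.
have -> : (ord0 : 'I_n.+1) = lshift n (ord0 : 'I_1) by exact/val_inj.
by rewrite (@row_mxEl _ 1 1 n) mxE.
Qed.

Let measurable_rV_cons n : measurable_fun setT (@rV_cons n).
Proof.
apply: measurable_fun_rV => i.
have [j ->|j ->] := @split_ordP 1 n i.
  rewrite (_ : (fun _ => _) = fst); first exact: measurable_fst.
  by apply/funext => p; rewrite /rV_cons (@row_mxEl _ 1 1 n) mxE.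
rewrite (_ : (fun _ => _) = (fun x : 'rV[R]_n => x ord0 j) \o snd).
  exact: (measurableT_comp (measurable_coord j) measurable_snd).
by apply/funext => p; rewrite /rV_cons (@row_mxEr _ 1 1 n).
Qed.

Let measurable_rV_uncons n : measurable_fun setT (@rV_uncons n).
Proof.
apply/measurable_fun_pairP; split; first exact: measurable_coord.
apply: measurable_fun_rV => i.
rewrite (_ : (fun _ => _) = fun x : 'rV[R]_n.+1 => x ord0 (rshift 1 i)).
  exact: measurable_coord.
by apply/funext => x /=; rewrite mxE.
Qed.

Let lebesgue_rV_ex n :
  exists m : {sigma_finite_measure set 'rV[R]_n -> \bar R},
    m = @lebesgue_rV n :> (set 'rV[R]_n -> \bar R).
Proof.
elim: n => [|n [m mE]]; first by exists \d_(0 : 'rV[R]_0).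
pose leb : {sigma_finite_measure set (measurableTypeR R) -> \bar R} :=
  @lebesgue_measure R.
have mu_sf : sigma_finite setT (pushforward (leb \x m)%E (@rV_cons n)).
  have /sigma_finiteP[F [TF ndF Foo]] := sigma_finiteT leb.
  have /sigma_finiteP[G [TG ndG Goo]] := sigma_finiteT m.
  exists (fun k => @rV_uncons n @^-1` (F k `*` G k)).
    rewrite -preimage_bigcup; apply/esym/seteqP; split => // x _.
    have [k _ Fk] : (\bigcup_k F k) (rV_uncons x).1 by rewrite -TF.
    have [l _ Gl] : (\bigcup_k G k) (rV_uncons x).2 by rewrite -TG.
    exists (maxn k l) => //; split.
    - by move: Fk; exact/subsetPset/ndF/leq_maxl.
    - by move: Gl; exact/subsetPset/ndG/leq_maxr.
  move=> k; have [mF Fk] := Foo k; have [mG Gk] := Goo k; split.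
    rewrite -[X in measurable X]setTI; apply: measurable_rV_uncons => //.
    exact: measurableX.
  rewrite /pushforward (_ : _ @^-1` _ = F k `*` G k).
    by rewrite product_measure1E// lte_mul_pinfty// ge0_fin_numE.
  by apply/funext => p; rewrite -[in RHS](@rV_consK n p).
pose mu := measure_function_pushforward__canonical__measure_function_Measure
  (leb \x m)%E (@measurable_rV_cons n).
pose H1 := isSFinite.Build _ _ _ mu (sfinite_measure_sigma_finite mu_sf).
pose H2 := isSigmaFinite.Build _ _ _ mu mu_sf.
pose mu' := HB.pack_for {sigma_finite_measure set 'rV[R]_n.+1 -> \bar R}
  (Measure.sort mu) H1 H2.
by exists mu'; rewrite /= -mE.
Qed.

Let lebesgue_rV0 n : @lebesgue_rV n set0 = 0%E.
Proof. by have [m <-] := lebesgue_rV_ex n; rewrite measure0. Qed.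

Let lebesgue_rV_ge0 n A : (0 <= @lebesgue_rV n A)%E.
Proof. by have [m <-] := lebesgue_rV_ex n. Qed.

Let lebesgue_rV_semi_sigma_additive n : semi_sigma_additive (@lebesgue_rV n).
Proof.
by have [m <-] := lebesgue_rV_ex n; exact: measure_semi_sigma_additive.
Qed.

HB.instance Definition _ n := isMeasure.Build _ _ _ (@lebesgue_rV n)
  (lebesgue_rV0 n) (@lebesgue_rV_ge0 n) (@lebesgue_rV_semi_sigma_additive n).

Let lebesgue_rV_sigma_finite n : sigma_finite setT (@lebesgue_rV n).
Proof. by have [m <-] := lebesgue_rV_ex n; exact: sigma_finiteT. Qed.

HB.instance Definition _ n := Measure_isSigmaFinite.Build _ _ _
  (@lebesgue_rV n) (@lebesgue_rV_sigma_finite n).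

End lebesgue_rV.
Arguments lebesgue_rV {R} n.

Definition I01 {R : realType} : set R := `[0, 1]%classic.

Section euclidean.
Context {R : realType} {d : nat}.
Implicit Types (x y : 'rV[R]_d) (g : 'rV[R]_d -> R).

Definition dotr x y : R := \sum_(i < d) x ord0 i * y ord0 i.

(* The library norm `|x| on row vectors is the sup norm. *)
Definition enorm x : R := Num.sqrt (dotr x x).

Definition partial (i : 'I_d) g : 'rV[R]_d -> R :=
  fun x => 'D_(delta_mx ord0 i) g x.

Definition grad g x : 'rV[R]_d := \row_i partial i g x.

(* Iterated partial derivative along a list of directions (multi-indices with
   an order of differentiation). *)
Definition pderiv (s : seq 'I_d) g : 'rV[R]_d -> R := foldr partial g s.

Definition smooth g : Prop := forall s : seq 'I_d,
  continuous (pderiv s g) /\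
  forall (i : 'I_d) x, derivable (pderiv s g) x (delta_mx ord0 i).

Definition Cb_infty g : Prop :=
  smooth g /\
  forall s : seq 'I_d, exists M : R, forall x, `|pderiv s g x| <= M.

(* Representatives of elements of L^infty([0, 1]; C^infty_b): smoothness and the
   bounds on each derivative hold for almost every t, uniformly in x. *)
Definition Linfty_Cb (f : R -> 'rV[R]_d -> R) : Prop :=
  [/\ forall x, measurable_fun I01 (fun t => f t x),
      {ae @lebesgue_measure R, forall t, I01 t -> Cb_infty (f t)} &
      forall s : seq 'I_d, exists M : R,
        {ae @lebesgue_measure R, forall t, I01 t ->
          forall x, `|pderiv s (f t) x| <= M}].

(* Continuity in time for the Frechet topology of C^infty_b given by the
   seminorms g |-> sup_x `|pderiv s g x|. *)
Definition C_Cb (u : R -> 'rV[R]_d -> R) : Prop :=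
  (forall t, I01 t -> Cb_infty (u t)) /\
  forall (s : seq 'I_d) (t e : R), I01 t -> 0 < e ->
    \forall t' \near within I01 (nbhs t),
      forall x, `|pderiv s (u t') x - pderiv s (u t) x| <= e.

Definition sup_norm g : \bar R :=
  ereal_sup [set `|g x|%:E | x in [set: 'rV[R]_d]].

Definition sup_norm01 (f : R -> 'rV[R]_d -> R) : \bar R :=
  ereal_sup [set `|f p.1 p.2|%:E | p in I01 `*` [set: 'rV[R]_d]].

Definition holder_seminorm (beta : R) g : \bar R :=
  ereal_sup [set (`|g p.1 - g p.2| / enorm (p.1 - p.2) `^ beta)%:E |
    p in [set p : 'rV[R]_d * 'rV[R]_d | p.1 != p.2 /\ enorm (p.1 - p.2) <= 1]].

Definition levy_op (nu : {measure set 'rV[R]_d -> \bar R}) g x : R :=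
  \int[nu]_y (g (x + y) - g x - \1_[set z | enorm z <= 1] y * dotr y (grad g x)).

End euclidean.

(* Main.v *)
Require Import Defs.
From HB Require Import structures.
From mathcomp Require Import all_boot all_order all_algebra.
From mathcomp Require Import all_classical all_reals all_analysis.
From mathcomp Require Import measurable_realfun ring lra.

Set Implicit Arguments.
Unset Strict Implicit.
Unset Printing Implicit Defensive.

Import Order.TTheory GRing.Theory Num.Theory.
Import numFieldNormedType.Exports.

Local Open Scope classical_set_scope.
Local Open Scope ring_scope.

(** The estimate is a doubling-of-variables (Ishii-Lions) argument run with a
    coalescing coupling of jumps. Put [r = |x - y|] and compare
    [u t x - u t y] with the barrier [K r^be], where [K = K0 + 2 F t] and [F]
    bounds the source; [B] bounds the drift and [kappa] is a dimensional
    multiple of the lower bound [c1] of the kernel. Suppose that at some time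
    the difference stays below the barrier and touches it at a pair [(x, y)].

    - The gradients of [u] at [x] and [y] agree, so the compensators cancel, and
      translating both points by the same jump [z] leaves [r] unchanged, so the
      difference of the two Levy integrands is nonpositive at every [z]. The
      Levy measure may thus be replaced by a smaller one, which is why the
      upper bound of the kernel does not enter the constants.
    - For [z] in a cube of side comparable to [r] around [(y - x) / 2], the
      jumps [z] and [z + (x - y)] satisfy [x + z = y + (z + (x - y))]. Summing
      the two integrands, the common value cancels and there remains a
      difference at distance [2 r], so the sum is at most
      [K ((2 r)^be - 2 r^be) <= - K (1 - be) r^be]
      ([coalescing_levy_integrand]). The Levy measure of such cubes is at least
      a constant times [1 / r] ([coalescing_mass]), so the Levy term yields a
      gain of order [kappa K (1 - be) r^(be - 1)], which does not degenerate
      as [be] tends to [0].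
    - At a maximum both gradients have norm at most [K be r^(be - 1)], so the
      critical drift costs at most [2 B K be r^(be - 1)]. It is beaten by the
      gain as soon as [be] is small compared with [kappa / (kappa + B)].
    - The source costs [2 F]: for [r <= 1] the remaining gain, of order
      [kappa K r^(be - 1)], absorbs it when [K] is a large multiple of [F];
      for [r >= 1] the growth [2 F r^be] of the barrier does
      ([barrier_balance]), so the supremum of [u] never enters.

    Since space is not compact, maxima are only approximate. The barrier is
    raised by [th (1 + t)], and [almost_max_levy_op] gives the previous bounds
    up to an arbitrarily small error at every pair that is within [ep] of a
    maximum; the errors are controlled by Taylor expansions and by dominated
    convergence with the integrable weight [min 1 |z|^2]. In time the argument
    is run at the infimum [t0] of the times at which the barrier is crossed: a
    crossing at a slightly later time [t1] provides an almost maximal pair at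
    [t0], along which the difference grows more slowly than the barrier on
    [[t0, t1]]. As [b] and [f] are merely measurable in time, this is done on
    the integral form of the equation, with the Levy term and the gradients
    frozen at [t0]. *)

(** * Lebesgue measure on row vectors *)

Section lebesgue_rV_theory.
Context {R : realType}.
Implicit Types n : nat.

Definition cbox n (w : 'rV[R]_n) (r : R) : set 'rV[R]_n :=
  [set z | forall i, `|z ord0 i - w ord0 i| <= r].

Lemma measurable_cbox n (w : 'rV[R]_n) r : measurable (cbox w r).
Proof.
have -> : cbox w r = \bigcap_(i in [set: 'I_n])
    ((fun z : 'rV[R]_n => z ord0 i) @^-1` `[w ord0 i - r, w ord0 i + r]%classic).
  apply/seteqP; split => z /= h i; first by move=> _ /=; rewrite in_itv/= -ler_distl.
  by have := h i Logic.I; rewrite /= in_itv/= -ler_distl.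
apply: fin_bigcap_measurable => // i _.
by rewrite -[X in measurable X]setTI; exact: measurable_coord.
Qed.

Lemma rV_cons0 n (p : measurableTypeR R * 'rV[R]_n) : rV_cons p ord0 ord0 = p.1.
Proof.
rewrite /rV_cons (_ : (ord0 : 'I_n.+1) = lshift n (ord0 : 'I_1)); last exact/val_inj.
by rewrite (@row_mxEl _ 1 1 n) mxE.
Qed.

Lemma rV_consS n (p : measurableTypeR R * 'rV[R]_n) j :
  rV_cons p ord0 (rshift 1 j) = p.2 ord0 j.
Proof. by rewrite /rV_cons (@row_mxEr _ 1 1 n). Qed.

Lemma measurable_rV_cons n : measurable_fun setT (@rV_cons R n).
Proof.
apply: measurable_fun_rV => i; have [j ->|j ->] := @split_ordP 1 n i.
  rewrite (_ : (fun _ => _) = fst); first exact: measurable_fst.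
  by apply/funext => p; rewrite (_ : lshift n j = ord0) ?rV_cons0 ?ord1//; exact/val_inj.
rewrite (_ : (fun _ => _) = (fun x : 'rV[R]_n => x ord0 j) \o snd).
  exact: (measurableT_comp (measurable_coord j) measurable_snd).
by apply/funext => p; rewrite rV_consS.
Qed.

Lemma lebesgue_rV_cbox n (w : 'rV[R]_n) (r : R) : 0 <= r ->
  lebesgue_rV n (cbox w r) = ((2 * r) ^+ n)%:E.
Proof.
move=> r0; elim: n w => [|n IH] w.
  rewrite expr0 /= diracE (_ : _ \in _ = true)//.
  by apply/mem_set => -[].
rewrite /= /pushforward.
pose w2 : 'rV[R]_n := \row_j w ord0 (rshift 1 j).
rewrite (_ : _ @^-1` _ = `[w ord0 ord0 - r, w ord0 ord0 + r]%classic `*` cbox w2 r); last first.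
  apply/seteqP; split => -[s x] /=.
    move=> h; split.
      by have := h ord0; rewrite rV_cons0 /= in_itv/= -ler_distl.
    by move=> j; have := h (rshift 1 j); rewrite rV_consS mxE.
  rewrite in_itv/= -ler_distl => -[h1 h2] i.
  have [j ->|j ->] := @split_ordP 1 n i.
    by rewrite (_ : lshift n j = ord0) ?rV_cons0 ?ord1//; exact/val_inj.
  by have := h2 j; rewrite rV_consS mxE.
rewrite product_measure1E//=; last exact: measurable_cbox.
rewrite IH exprS EFinM; congr (_ * _)%E.
rewrite lebesgue_measure_itv/= lte_fin; case: ltP => h.
  by rewrite -EFinD; congr EFin; ring.
by congr EFin; lra.
Qed.

Lemma lebesgue_measure_shift (h : R) (A : set (measurableTypeR R)) : measurable A ->
  lebesgue_measure ((fun z => z + h) @^-1` A) = lebesgue_measure A.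
Proof.
pose S : measurableTypeR R -> measurableTypeR R := fun z : R => z + h.
have mh : measurable_fun setT S by exact: measurable_funD.
pose m := measure_function_pushforward__canonical__measure_function_Measure
  (@lebesgue_measure R) mh.
move=> mA; symmetry; apply: (lebesgue_measure_unique (mu := m)) => // _ [[a b] _ <-].
rewrite /m /= /pushforward.
rewrite (_ : _ @^-1` _ = `]a - h, b - h]%classic); last first.
  by apply/seteqP; split => z /=; rewrite !in_itv/= ltrBlDr lerBrDr.
rewrite !lebesgue_measure_itv/= !lte_fin ltrD2r; case: ifP => // _.
by rewrite -!EFinD; congr EFin; ring.
Qed.

Lemma measurable_shift n (h : 'rV[R]_n) :
  measurable_fun [set: 'rV[R]_n] (fun z => z + h).
Proof.
apply: measurable_fun_rV => i.
rewrite (_ : (fun _ => _) = (fun z : 'rV[R]_n => z ord0 i + h ord0 i)).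
  by apply: measurable_funD => //; exact: measurable_coord.
by apply/funext => z; rewrite mxE.
Qed.

(** A translation of the product is a product of translations, so uniqueness
    of the product measure reduces the claim to dimension one. *)
Lemma lebesgue_rV_shift n (h : 'rV[R]_n) (A : set 'rV[R]_n) : measurable A ->
  lebesgue_rV n ((fun z => z + h) @^-1` A) = lebesgue_rV n A.
Proof.
elim: n h A => [|n IH] h A mA.
  congr (lebesgue_rV 0 _); apply/seteqP; split => z /=;
  by rewrite (_ : z + h = z)//; apply/rowP => -[].
pose h2 : 'rV[R]_n := \row_j h ord0 (rshift 1 j).
pose T (p : measurableTypeR R * 'rV[R]_n) : measurableTypeR R * 'rV[R]_n :=
  (p.1 + h ord0 ord0, p.2 + h2).
have mT : measurable_fun setT T.
  apply: measurable_fun_pair => /=.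
    exact: measurable_funD.
  exact: (measurableT_comp (measurable_shift h2) measurable_snd).
have consT p : rV_cons p + h = rV_cons (T p).
  apply/rowP => i; rewrite mxE; have [j ->|j ->] := @split_ordP 1 n i.
    by rewrite (_ : lshift n j = ord0) ?rV_cons0 ?ord1//; exact/val_inj.
  by rewrite !rV_consS !mxE.
rewrite /= /pushforward.
rewrite (_ : _ @^-1` _ = T @^-1` (@rV_cons R n @^-1` A)); last first.
  by apply/seteqP; split => p /=; rewrite consT.
pose leb : {sigma_finite_measure set (measurableTypeR R) -> \bar R} :=
  @lebesgue_measure R.
pose m := measure_function_pushforward__canonical__measure_function_Measure
  (leb \x @lebesgue_rV R n)%E mT.
symmetry; apply: (product_measure_unique (m1 := leb) (m2 := @lebesgue_rV R n) (m' := m)).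
  move=> X Y mX mY; rewrite /m /= /pushforward.
  rewrite (_ : _ @^-1` _ = ((fun z => z + h ord0 ord0) @^-1` X) `*`
     ((fun z => z + h2) @^-1` Y))//.
  rewrite product_measure1E//=.
  - by rewrite lebesgue_measure_shift// IH.
  - by rewrite -[X in measurable X]setTI; exact: measurable_funD.
  - by rewrite -[X in measurable X]setTI; exact: measurable_shift.
by rewrite -[X in measurable X]setTI; exact: measurable_rV_cons.
Qed.

End lebesgue_rV_theory.

(** * The Euclidean norm *)

Section enorm_theory.
Context {R : realType} {d : nat}.
Implicit Types x y : 'rV[R]_d.

Lemma dotrC x y : dotr x y = dotr y x.
Proof. by apply: eq_bigr => i _; rewrite mulrC. Qed.

Lemma dotrDl x y z : dotr (x + y) z = dotr x z + dotr y z.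
Proof. by rewrite /dotr -big_split; apply: eq_bigr => i _; rewrite mxE mulrDl. Qed.

Lemma dotrZl (k : R) x y : dotr (k *: x) y = k * dotr x y.
Proof. by rewrite /dotr mulr_sumr; apply: eq_bigr => i _; rewrite mxE mulrA. Qed.

Lemma dotrNl x y : dotr (- x) y = - dotr x y.
Proof. by rewrite -scaleN1r dotrZl mulN1r. Qed.

Lemma dotrBr x y z : dotr z (x - y) = dotr z x - dotr z y.
Proof. by rewrite dotrC dotrDl dotrNl !(dotrC z). Qed.

Lemma dotrr_ge0 x : 0 <= dotr x x.
Proof. by apply: sumr_ge0 => i _; rewrite -expr2 sqr_ge0. Qed.

Lemma enorm_ge0 x : 0 <= enorm x. Proof. exact: sqrtr_ge0. Qed.

Lemma enorm_sqr x : enorm x ^+ 2 = dotr x x.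
Proof. by rewrite sqr_sqrtr// dotrr_ge0. Qed.

Lemma enormZ (k : R) x : enorm (k *: x) = `|k| * enorm x.
Proof.
rewrite /enorm dotrZl dotrC dotrZl.
by rewrite mulrA -expr2 sqrtrM ?sqr_ge0// sqrtr_sqr.
Qed.

Lemma enormN x : enorm (- x) = enorm x.
Proof. by rewrite -scaleN1r enormZ normrN1 mul1r. Qed.

Lemma enormB x y : enorm (x - y) = enorm (y - x).
Proof. by rewrite -opprB enormN. Qed.

Lemma coord_le_enorm x i : `|x ord0 i| <= enorm x.
Proof.
rewrite -sqrtr_sqr ler_sqrt ?dotrr_ge0// /dotr (bigD1 i)//= -expr2 lerDl.
by apply: sumr_ge0 => j _; rewrite -expr2 sqr_ge0.
Qed.

Lemma enorm_eq0 x : (enorm x == 0) = (x == 0).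
Proof.
apply/eqP/eqP => [x0|->]; last by rewrite -(scale0r 0) enormZ normr0 mul0r.
apply/rowP => i; rewrite mxE; apply/eqP; rewrite -normr_le0 -x0.
exact: coord_le_enorm.
Qed.

Lemma enorm0 : enorm (0 : 'rV[R]_d) = 0.
Proof. by apply/eqP; rewrite enorm_eq0. Qed.

Lemma enorm_gt0 x : (0 < enorm x) = (x != 0).
Proof. by rewrite lt_def enorm_eq0 enorm_ge0 andbT. Qed.

(** Expand the square of the component of [x] orthogonal to [y]. *)
Lemma CauchySchwarz_dotr x y : `|dotr x y| <= enorm x * enorm y.
Proof.
rewrite -(@ler_pXn2r _ 2)// ?nnegrE ?mulr_ge0 ?enorm_ge0//.
rewrite -normrX ger0_norm ?sqr_ge0// exprMn !enorm_sqr.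
have [->|y0] := eqVneq y 0.
  rewrite -[X in dotr x X](scale0r 0) dotrC dotrZl mul0r expr0n/=.
  by rewrite mulr_ge0// dotrr_ge0.
have yy : 0 < dotr y y by rewrite -enorm_sqr exprn_gt0// enorm_gt0.
pose z := dotr y y *: x - dotr x y *: y.
have := dotrr_ge0 z.
have -> : dotr z z = dotr y y * (dotr x x * dotr y y - dotr x y ^+ 2).
  rewrite {1}/z dotrDl dotrNl !dotrZl dotrC [dotr y z]dotrC /z.
  by rewrite !dotrDl !dotrNl !dotrZl (dotrC y x); ring.
by rewrite pmulr_rge0// subr_ge0.
Qed.

Lemma ler_enormD x y : enorm (x + y) <= enorm x + enorm y.
Proof.
rewrite -(@ler_pXn2r _ 2)// ?nnegrE ?addr_ge0 ?enorm_ge0//.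
rewrite enorm_sqr dotrDl !(dotrC _ (x + y)) !dotrDl sqrrD !enorm_sqr (dotrC y x).
have := le_trans (ler_norm _) (CauchySchwarz_dotr x y); lra.
Qed.

Lemma enorm_le_sum x : enorm x <= \sum_(i < d) `|x ord0 i|.
Proof.
have s0 (P : pred 'I_d) : 0 <= \sum_(i < d | P i) `|x ord0 i|.
  by apply: sumr_ge0.
rewrite -(@ler_pXn2r _ 2)// ?nnegrE ?enorm_ge0//.
rewrite enorm_sqr expr2 mulr_suml; apply: ler_sum => i _.
rewrite -expr2 -real_normK ?num_real// expr2 ler_wpM2l//.
by rewrite (bigD1 i)//= lerDl.
Qed.

Lemma enorm_le_card x (s : R) : (forall i, `|x ord0 i| <= s) -> enorm x <= d%:R * s.
Proof.
move=> h; apply: (le_trans (enorm_le_sum x)).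
by apply: (le_trans (ler_sum _ (fun i _ => h i))); rewrite sumr_const card_ord mulr_natl.
Qed.

Lemma sum_le_enorm x : \sum_(i < d) `|x ord0 i| <= d%:R * enorm x.
Proof.
apply: (le_trans (ler_sum _ (fun i _ => coord_le_enorm x i))).
by rewrite sumr_const card_ord mulr_natl.
Qed.

Lemma measurable_enorm : measurable_fun setT (enorm : 'rV[R]_d -> R).
Proof.
rewrite (_ : enorm = (fun z => z `^ 2^-1) \o (fun x => dotr x x)).
  apply: measurableT_comp; first exact: measurable_powR.
  apply: measurable_sum => i.
  by apply: measurable_funM; exact: measurable_coord.
by apply/funext => x /=; rewrite powR12_sqrt// dotrr_ge0.
Qed.

(** The sigma-algebra is generated by the coordinates, so an open set has to be
    written as a countable union of cubes with rational centres. *)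
Lemma continuous_measurable_rV (g : 'rV[R]_d -> R) :
  continuous g -> measurable_fun setT g.
Proof.
move=> cg; apply: (measurability _ (RGenOpens.measurableE R)).
move=> _ [_ [a [b ->] <-]]; rewrite setTI.
have : open (g @^-1` `]a, b[%classic).
  by apply: open_comp => //; exact: interval_open.
set U := _ @^-1` _ => oU.
pose q (p : 'rV[rat]_d * nat) : 'rV[R]_d := \row_i ratr (p.1 ord0 i).
pose F (p : 'rV[rat]_d * nat) : set 'rV[R]_d :=
  if `[< cbox (q p) p.2.+1%:R^-1 `<=` U >] then cbox (q p) p.2.+1%:R^-1 else set0.
rewrite (_ : U = \bigcup_p F p).
  apply: countable_bigcupT_measurable => // p.
  by rewrite /F; case: asboolP => _//; exact: measurable_cbox.
apply/seteqP; split => [x Ux|x [p _]]; last first.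
  by rewrite /F; case: asboolP => // h /h.
have [e/= e0 xeU] : exists2 e : R, 0 < e & ball x e `<=` U.
  by have := oU; rewrite openE => /(_ _ Ux); rewrite /interior => /nbhs_ballP[e]; exists e.
have [k ke] : exists k, 2 * k.+1%:R^-1 < e.
  have [k ke] := ltr_add_invr (y := 0) (x := e / 2) (divr_gt0 e0 (ltr0Sn R 1)).
  by exists k; rewrite mulrC -ltr_pdivlMr//; move: ke; rewrite add0r.
have k0 : 0 < k.+1%:R^-1 :> R by rewrite invr_gt0.
pose t : R := k.+1%:R^-1; rewrite -/t in ke k0.
have /(_ _)/cid-/all_sig[r hr] : forall i, exists r : rat, `|x ord0 i - ratr r| <= t.
  move=> i; have : x ord0 i < x ord0 i + t by rewrite ltrDl.
  by move=> /rat_in_itvoo[r]; rewrite in_itv/= => /andP[h1 h2]; exists r;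
     rewrite ler_norml; apply/andP; split; lra.
exists (\row_i r i, k) => //; rewrite /F.
have xq i : q (\row_i r i, k) ord0 i = ratr (r i) by rewrite !mxE.
rewrite asboolT; first by move=> i; rewrite xq.
move=> z hz; apply: xeU; split => // i j; rewrite ord1 /ball/=.
have := hz j; have := hr j; rewrite xq/= => h1; rewrite -/t => h2.
rewrite (_ : _ - _ = (x ord0 j - ratr (r j)) - (z ord0 j - ratr (r j))); last by ring.
by apply: (le_lt_trans (ler_normB _ _)); lra.
Qed.

End enorm_theory.

Lemma nneseries_half (R : realType) (c : R) :
  (\sum_(k <oo) (c / 2 ^+ k.+1)%:E = c%:E)%E.
Proof.
have := @cvg_geometric_eseries_half R c 0%N; rewrite expr0 divr1 => h.
apply/cvg_lim => //.
rewrite (_ : (fun n : nat => _) = eseries (fun k => (c / (2 ^ (k + 1))%:R)%:E))//.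
by apply/funext => n; apply: eq_bigr => k _; rewrite addn1 natrX.
Qed.

(** * The Levy measure *)

(** Ellipticity from below, in the only form that the coupling uses; it keeps
    the final constants independent of the upper bound on the kernel. *)
Definition levy_lower_bound (R : realType) (d : nat) (c1 : R)
    (nu : {measure set 'rV[R]_d -> \bar R}) : Prop :=
  forall (A : set 'rV[R]_d) (r : R), measurable A ->
    (forall z, A z -> 0 < enorm z <= r) ->
    ((c1 / r ^+ d.+1)%:E * lebesgue_rV d A <= nu A)%E.

(** A quadratic increment near the origin and a bounded one far away: up to a
    factor it dominates every compensated increment of a smooth bounded
    function. *)
Definition levy_weight (R : realType) (d : nat) (z : 'rV[R]_d) : R :=
  Num.min 1 (enorm z ^+ 2).

Section levy_measure.
Context {R : realType} {d : nat}.
Variables (c1 c2 : R) (a : 'rV[R]_d -> R) (nu : {measure set 'rV[R]_d -> \bar R}).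
Hypothesis c1_gt0 : 0 < c1.
Hypothesis ma : measurable_fun [set: 'rV[R]_d] a.
Hypothesis a_bnd : forall y, c1 <= a y <= c2.
Hypothesis nuE : forall A, measurable A ->
  nu A = (\int[lebesgue_rV d]_(y in A) (a y / enorm y ^+ d.+1)%:E)%E.

Let a_ge0 y : 0 <= a y.
Proof. by have /andP[+ _] := a_bnd y; apply: le_trans; exact: ltW. Qed.

Let c2_ge0 : 0 <= c2.
Proof. by have /andP[_] := a_bnd 0; apply: le_trans; exact: a_ge0. Qed.

Let dens_ge0 y : 0 <= a y / enorm y ^+ d.+1.
Proof. by rewrite divr_ge0// exprn_ge0// enorm_ge0. Qed.

Let measurable_dens :
  measurable_fun setT (fun y : 'rV[R]_d => a y / enorm y ^+ d.+1).
Proof.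
apply: measurable_funM => //.
rewrite (_ : (fun _ => _) = (fun z => z ^+ d.+1) \o (fun z => z `^ (-1)) \o
    (enorm : 'rV[R]_d -> R)).
  apply: measurableT_comp; last exact: measurable_enorm.
  apply: measurableT_comp; last exact: measurable_powR.
  by apply: measurable_funX.
by apply/funext => y /=; rewrite powR_inv1 ?enorm_ge0// exprVn.
Qed.

Let measurable_densE (A : set 'rV[R]_d) :
  measurable_fun A (fun y => (a y / enorm y ^+ d.+1)%:E).
Proof. by apply: measurable_funTS; exact/measurable_EFinP. Qed.

Lemma measurable_enorm_ge (rho : R) : measurable [set z : 'rV[R]_d | rho <= enorm z].
Proof.
rewrite (_ : [set _ | _] = enorm @^-1` `[rho, +oo[%classic).
  by rewrite -[X in measurable X]setTI; exact: measurable_enorm.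
by apply/seteqP; split => z /=; rewrite in_itv/= andbT.
Qed.

Lemma nu_shell_le (A : set 'rV[R]_d) (rho s : R) : measurable A -> 0 < rho -> 0 <= s ->
  (forall z, A z -> rho <= enorm z <= s) ->
  (nu A <= (c2 / rho ^+ d.+1 * (2 * s) ^+ d)%:E)%E.
Proof.
move=> mA rho0 s0 hA; rewrite nuE//.
have k0 : 0 <= c2 / rho ^+ d.+1 by rewrite divr_ge0// exprn_ge0// ltW.
apply: (@le_trans _ _ (\int[lebesgue_rV d]_(y in A) cst (c2 / rho ^+ d.+1)%:E y)%E).
  apply: ge0_le_integral => //.
    by move=> x _; rewrite lee_fin.
  move=> x /hA/andP[h _]; rewrite lee_fin.
  have /andP[_ ax] := a_bnd x.
  apply: ler_pM => //; first by rewrite invr_ge0 exprn_ge0// enorm_ge0.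
  rewrite lef_pV2 ?posrE ?exprn_gt0//; last exact: lt_le_trans h.
  by rewrite lerXn2r// nnegrE ?enorm_ge0// ltW.
rewrite integral_cst// [leRHS]EFinM; apply: lee_wpmul2l; first by rewrite lee_fin.
rewrite -(lebesgue_rV_cbox (0 : 'rV[R]_d) s0); apply: le_measure; rewrite ?inE//.
  exact: measurable_cbox.
move=> z /hA/andP[_ zs] i; rewrite mxE subr0.
exact: le_trans (coord_le_enorm z i) zs.
Qed.

Lemma nu_lower_bound : levy_lower_bound c1 nu.
Proof.
move=> A r mA hA; rewrite nuE//.
have [->|/set0P[z0 /hA/andP[z00 z0r]]] := eqVneq A set0.
  by rewrite measure0 mule0; apply: integral_ge0 => y _; rewrite lee_fin.
have r0 : 0 < r by exact: lt_le_trans z0r.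
have k0 : 0 <= c1 / r ^+ d.+1 by rewrite divr_ge0// ?ltW// exprn_gt0.
rewrite -integral_cst//; apply: ge0_le_integral => // x /hA/andP[h1 h2].
rewrite lee_fin; have /andP[ax _] := a_bnd x.
apply: ler_pM => //; first exact: ltW.
  by rewrite invr_ge0 exprn_ge0// ltW.
rewrite lef_pV2 ?posrE ?exprn_gt0//.
by rewrite lerXn2r// nnegrE ?enorm_ge0// ltW.
Qed.

(** Dyadic shells: the shell of radius [2^k rho] has mass of order
    [1 / (2^k rho)], being a kernel of order [(2^k rho)^-(d+1)] integrated over
    a volume of order [(2^k rho)^d]. *)
Lemma nu_tail_le (rho : R) : 0 < rho ->
  (nu [set z | (rho <= enorm z)%R] <= (c2 * 4 ^+ d * 2 / rho)%:E)%E.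
Proof.
move=> rho0.
pose A k := [set z : 'rV[R]_d | 2 ^+ k * rho <= enorm z <= 2 ^+ k.+1 * rho].
have mA k : measurable (A k).
  rewrite (_ : A k = enorm @^-1` `[2 ^+ k * rho, 2 ^+ k.+1 * rho]%classic).
    by rewrite -[X in measurable X]setTI; exact: measurable_enorm.
  by apply/seteqP; split => z /=; rewrite in_itv/=.
apply: (@le_trans _ _ (\sum_(k <oo) nu (A k))%E).
  apply: measure_sigma_subadditive => //; first exact: measurable_enorm_ge.
  move=> z /= zrho.
  have exk : exists k, (enorm z < 2 ^+ k.+1 * rho).
    exists (Num.bound (enorm z / rho)); rewrite -ltr_pdivrMr//.
    apply: (lt_trans (archi_boundP (divr_ge0 (enorm_ge0 z) (ltW rho0)))).
    by rewrite -natrX ltr_nat (leq_trans (ltn_expl _ (isT : (1 < 2)%N)))// leq_exp2l.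
  case: (ex_minnP exk) => k hk kmin; exists k => //=; apply/andP; split; last exact: ltW.
  case: k hk kmin => [|k] hk kmin; first by rewrite expr0 mul1r.
  by rewrite leNgt; apply/negP => /kmin; rewrite ltnn.
rewrite -nneseries_half; apply: lee_nneseries => // k _.
have s0 : 0 < 2 ^+ k * rho by rewrite mulr_gt0// exprn_gt0.
apply: (le_trans (nu_shell_le (mA k) s0 _ (fun z h => h))).
  by rewrite mulr_ge0// ?exprn_ge0// ltW.
rewrite lee_fin [2 ^+ k.+1]exprS (_ : 2 * (2 * _ * _) = 4 * (2 ^+ k * rho)); last by ring.
rewrite [(4 * _) ^+ d]exprMn (exprS (2 ^+ k * rho)).
have := exprn_gt0 d s0; move: (_ ^+ d) => x x0.
rewrite le_eqVlt; apply/orP; left; apply/eqP.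
have := exprn_gt0 k (ltr0Sn R 1); move: (2 ^+ k) => y y0.
by field; rewrite !gt_eqF.
Qed.

Lemma levy_weight_ge0 (z : 'rV[R]_d) : 0 <= levy_weight z.
Proof. by rewrite le_min ler01 exprn_ge0// enorm_ge0. Qed.

Lemma measurable_levy_weight : measurable_fun setT (@levy_weight R d).
Proof.
have m2 : measurable_fun setT (fun z : 'rV[R]_d => enorm z ^+ 2).
  exact: measurable_funX measurable_enorm.
by apply: measurable_minr.
Qed.

(** The weight is below [\sum_k 4^-k 1_{|z| >= 2^-(k+1)}], and each tail has
    mass of order [2^k]. *)
Lemma integrable_levy_weight : nu.-integrable setT (EFin \o @levy_weight R d).
Proof.
apply/integrableP; split; first by apply/measurable_EFinP; exact: measurable_levy_weight.
pose E k := [set z : 'rV[R]_d | (2 ^+ k.+1)^-1 <= enorm z].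
pose f k z : \bar R := ((4 ^+ k)^-1 * \1_(E k) z)%:E.
have f_ge0 k z : (0 <= f k z)%E by rewrite lee_fin mulr_ge0.
have mE k : measurable (E k) by exact: measurable_enorm_ge.
have mf k : measurable_fun setT (f k).
  apply/measurable_EFinP; apply: measurable_funM => //.
apply: (@le_lt_trans _ _ (\int[nu]_z (\sum_(k <oo) f k z))%E).
  apply: ge0_le_integral => //.
  - by apply/measurable_EFinP/measurableT_comp => //; exact: measurable_levy_weight.
  - exact: ge0_emeasurable_sum.
  move=> z _; rewrite [leLHS]/= ger0_norm ?levy_weight_ge0//.
  have [->|z0] := eqVneq z 0.
    by rewrite /levy_weight enorm0 expr0n /= min_r// nneseries_ge0.
  have z0' : 0 < enorm z by rewrite enorm_gt0.
  have exk : exists k, (2 ^+ k.+1)^-1 <= enorm z.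
    exists (Num.bound (enorm z)^-1); rewrite -[leRHS]invrK lef_pV2 ?posrE ?invr_gt0 ?exprn_gt0//.
    apply: ltW; apply: (lt_trans (archi_boundP _)); first by rewrite invr_ge0 ltW.
    by rewrite -natrX ltr_nat (leq_trans (ltn_expl _ (isT : (1 < 2)%N)))// leq_exp2l.
  case: (ex_minnP exk) => k hk kmin.
  apply: (le_trans _ (nneseries_lim_ge k.+1 _)) => //.
  rewrite big_nat_recr//=; apply: (@le_trans _ _ (f k z)); last first.
    by apply: leeDr; apply: sume_ge0.
  rewrite lee_fin indicE mem_set// mulr1 /levy_weight ge_min; apply/orP.
  case: k hk kmin => [|k] hk kmin; [left|right]; first by rewrite expr0 invr1.
  have zk : enorm z <= (2 ^+ k.+1)^-1.
    by rewrite leNgt; apply/negP => /ltW/kmin; rewrite ltnn.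
  rewrite (_ : 4 = 2 ^+ 2); last by ring.
  rewrite -exprM mulnC exprM -exprVn lerXn2r// nnegrE ?enorm_ge0//.
rewrite integral_nneseries//.
apply: (@le_lt_trans _ _ (\sum_(k <oo) (c2 * 4 ^+ d * 2 * 4 / 2 ^+ k.+1)%:E)%E).
  apply: lee_nneseries => [k _ _|k _]; first exact: integral_ge0.
  rewrite /f; under eq_integral do rewrite EFinM.
  rewrite ge0_integralZl//; last by apply/measurable_EFinP.
  rewrite integral_indic// setIT.
  have t0 : 0 < (2 ^+ k.+1 : R)^-1 by rewrite invr_gt0 exprn_gt0.
  apply: (le_trans (lee_wpmul2l _ (nu_tail_le t0))) => //.
  rewrite -EFinM lee_fin (_ : 4 ^+ k = 2 ^+ k * 2 ^+ k); last first.
    by rewrite -exprMn (_ : 2 * 2 = 4)//; ring.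
  rewrite exprS le_eqVlt; apply/orP; left; apply/eqP.
  have := exprn_gt0 k (ltr0Sn R 1); move: (2 ^+ k) (4 ^+ d) => y x y0.
  by field; rewrite !gt_eqF.
by rewrite nneseries_half ltry.
Qed.

End levy_measure.

(** * Taylor bounds from partial derivatives *)

Section taylor.
Context {R : realType} {d : nat}.
Implicit Types (g : 'rV[R]_d -> R) (x h z : 'rV[R]_d) (i j : 'I_d).

Let e i : 'rV[R]_d := delta_mx ord0 i.

Lemma partial_mvt g i x (t : R) : (forall y, derivable g y (e i)) ->
  exists2 s : R, `|s| <= `|t| & g (x + t *: e i) - g x = t * partial i g (x + s *: e i).
Proof.
move=> dg; pose p (s : R) : R := g (x + s *: e i).
have quotE (s : R) : (fun h : R => h^-1 *: ((p \o shift s) (h *: 1) - p s)) =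
    (fun h : R => h^-1 *: ((g \o shift (x + s *: e i)) (h *: e i) - g (x + s *: e i))).
  apply/funext => h /=; rewrite /p; congr (_ *: (g _ - _)).
  by rewrite [h *: 1]mulr1 scalerDl addrCA addrA.
have dp (s : R) : is_derive s 1 p (partial i g (x + s *: e i)).
  by apply: DeriveDef; [rewrite /derivable quotE; exact: dg|rewrite /derive quotE].
have cp (b c : R) : {within `[b, c], continuous p}.
  by apply: derivable_within_continuous => s _; exact: (@ex_derive _ _ _ _ _ _ _ (dp s)).
have p0 : p 0 = g x by rewrite /p scale0r addr0.
have [t0|/ltW t0] := leP 0 t.
  have [s /andP[s0 st]] := MVT_segment t0 (fun s _ => dp s) (cp _ _).
  rewrite p0 subr0 => E; exists s; last by rewrite mulrC.
  by move: s0 st; rewrite !bnd_simp => s0 st; rewrite !ger0_norm.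
have [s /andP[s0 st]] := MVT_segment t0 (fun s _ => dp s) (cp _ _).
rewrite p0 sub0r => E; exists s; last by rewrite -/(p t) -opprB E mulrN opprK mulrC.
by move: s0 st; rewrite !bnd_simp => s0 st; rewrite !ler0_norm// lerN2.
Qed.

(** Go from [x] to [x + h] one coordinate at a time, with the mean value theorem
    on each coordinate line: smoothness is given through iterated partial
    derivatives, not through a differential. *)
Lemma coordinate_path g x h : (forall i y, derivable g y (e i)) ->
  exists2 xi : 'I_d -> 'rV[R]_d, (forall i j, `|xi i ord0 j| <= `|h ord0 j|) &
    g (x + h) - g x = \sum_(i < d) h ord0 i * partial i g (x + xi i).
Proof.
move=> dg; pose hk (k : nat) : 'rV[R]_d := \row_i (if (i < k)%N then h ord0 i else 0).
have hkS (i : 'I_d) : hk i.+1 = hk i + h ord0 i *: e i.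
  apply/rowP => j; rewrite !mxE eqxx /= ltnS leq_eqVlt.
  have [->|ji] := eqVneq j i; first by rewrite eqxx ltnn /= mulr1 add0r.
  by rewrite (negbTE (_ : (j : nat) != i)) //= mulr0 addr0.
have hkd : hk d = h by apply/rowP => j; rewrite mxE ltn_ord.
have hk0 : hk 0%N = 0 by apply/rowP => j; rewrite !mxE ltn0.
have /(_ _)/cid2-/all_sig2[s hs gs] := fun i : 'I_d =>
  partial_mvt (x + hk i) (h ord0 i) (dg i).
exists (fun i => hk i + s i *: e i).
  move=> i j; rewrite !mxE eqxx /=.
  have [->|ji] := eqVneq j i; first by rewrite ltnn /= mulr1 add0r.
  by rewrite mulr0 addr0; case: ifP => //; rewrite normr0.
rewrite -{1}hkd -[in X in _ - X](addr0 x) -hk0.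
rewrite -(telescope_sumr (fun k => g (x + hk k)))// big_mkord.
by apply: eq_bigr => i _; rewrite hkS !addrA gs.
Qed.

Lemma lipschitz_partial g (M : R) x h : (forall i y, derivable g y (e i)) ->
  (forall i y, `|partial i g y| <= M) ->
  `|g (x + h) - g x| <= M * \sum_(i < d) `|h ord0 i|.
Proof.
move=> dg gM; have [xi _ ->] := coordinate_path x h dg.
apply: (le_trans (ler_norm_sum _ _ _)); rewrite mulr_sumr; apply: ler_sum => i _.
by rewrite normrM mulrC ler_wpM2r.
Qed.

Lemma taylor2_partial g (M : R) x h : (forall i y, derivable g y (e i)) ->
  (forall i j y, derivable (partial i g) y (e j)) ->
  (forall i j y, `|partial j (partial i g) y| <= M) ->
  `|g (x + h) - g x - dotr h (grad g x)| <= M * (\sum_(i < d) `|h ord0 i|) ^+ 2.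
Proof.
move=> dg ddg gM; have [xi hxi ->] := coordinate_path x h dg.
rewrite /dotr -sumrB (le_trans (ler_norm_sum _ _ _))//.
rewrite expr2 mulrA mulr_sumr; apply: ler_sum => i _.
rewrite mxE -mulrBr normrM mulrC; apply: ler_wpM2r => //.
apply: (le_trans (lipschitz_partial x (xi i) (ddg i) (gM i))).
apply: ler_wpM2l; first exact: le_trans (normr_ge0 _) (gM i i x).
by apply: ler_sum => j _.
Qed.

Definition levy_integrand g x z : R :=
  g (x + z) - g x - \1_[set z | enorm z <= 1] z * dotr z (grad g x).

Lemma levy_integrand_bound g (M0 M2 : R) x z : (forall i y, derivable g y (e i)) ->
  (forall i j y, derivable (partial i g) y (e j)) ->
  (forall y, `|g y| <= M0) ->
  (forall i j y, `|partial j (partial i g) y| <= M2) ->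
  0 <= M2 ->
  `|levy_integrand g x z| <= (2 * M0 + d%:R ^+ 2 * M2) * levy_weight z.
Proof.
move=> dg ddg gM0 gM2 M20.
have M00 : 0 <= M0 by exact: le_trans (normr_ge0 _) (gM0 x).
rewrite /levy_integrand indicE; case: (leP (enorm z) 1) => z1.
  rewrite mem_set// mul1r (le_trans (taylor2_partial x z dg ddg gM2))//.
  rewrite /levy_weight min_r; last by rewrite expr_le1// enorm_ge0.
  rewrite mulrDl -[leLHS]add0r lerD//; first by rewrite !mulr_ge0 ?exprn_ge0 ?enorm_ge0.
  rewrite mulrAC mulrC ler_wpM2r// -exprMn lerXn2r// ?nnegrE.
  - exact: sumr_ge0.
  - by rewrite mulr_ge0// enorm_ge0.
  - exact: sum_le_enorm.
rewrite memNset; last by move=> /=; rewrite leNgt z1.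
rewrite mul0r subr0 /levy_weight min_l; last by rewrite exprn_ege1// ltW.
rewrite mulr1 (le_trans (ler_normB _ _))//.
have := gM0 (x + z); have := gM0 x.
have : 0 <= d%:R ^+ 2 * M2 by rewrite mulr_ge0// exprn_ge0.
lra.
Qed.

End taylor.

(** * The Levy operator on smooth bounded functions *)

Section levy_operator.
Context {R : realType} {d : nat}.
Implicit Types (g : 'rV[R]_d -> R) (x h z : 'rV[R]_d) (i j : 'I_d).

(** The finite part of membership in [C^infty_b] that the Levy operator sees.
    The bounds are parameters because they must be small for the difference of
    two time slices. *)
Record C2_bounded g (M0 M2 : R) : Prop := {
  C2b_continuous : continuous g ;
  C2b_derivable : forall i y, derivable g y (delta_mx ord0 i) ;
  C2b_derivable2 : forall i j y, derivable (partial i g) y (delta_mx ord0 j) ;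
  C2b_le0 : forall y, `|g y| <= M0 ;
  C2b_le2 : forall i j y, `|partial j (partial i g) y| <= M2 }.

Lemma C2_boundedB g g' (M0 M2 M0' M2' N0 N2 : R) :
  C2_bounded g M0 M2 -> C2_bounded g' M0' M2' ->
  (forall y, `|g y - g' y| <= N0) ->
  (forall i j y, `|partial j (partial i g) y - partial j (partial i g') y| <= N2) ->
  C2_bounded (fun y => g y - g' y) N0 N2 /\
  forall x, grad (fun y => g y - g' y) x = grad g x - grad g' x.
Proof.
move=> cg cg' h0 h2.
have pB i y : partial i (fun y => g y - g' y) y = partial i g y - partial i g' y.
  by apply: deriveB; [exact: C2b_derivable cg _ _|exact: C2b_derivable cg' _ _].
have pBE i : partial i (fun y => g y - g' y) = (fun y => partial i g y - partial i g' y).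
  by apply/funext => y.
split; last by move=> x; apply/rowP => i; rewrite !mxE pB.
split => //.
- by move=> y; apply: continuousB; [exact: (C2b_continuous cg)|exact: (C2b_continuous cg')].
- move=> i y; apply: derivableB; [exact: C2b_derivable cg _ _|exact: C2b_derivable cg' _ _].
- move=> i j y; rewrite pBE.
  by apply: derivableB; [exact: C2b_derivable2 cg _ _ _|exact: C2b_derivable2 cg' _ _ _].
- move=> i j y; rewrite pBE {1}/partial deriveB; first exact: h2.
  + exact: C2b_derivable2 cg _ _ _.
  + exact: C2b_derivable2 cg' _ _ _.
Qed.

Lemma Cb_infty_C2_bounded g : Cb_infty g ->
  exists M0 M2, [/\ 0 <= M0, 0 <= M2 & C2_bounded g M0 M2].
Proof.
move=> [sg bg].
have [M0 hM0] := bg [::].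
have /(_ _)/cid-/all_sig[M hM] := fun p : 'I_d * 'I_d => bg [:: p.1; p.2].
have M_ge0 p x : 0 <= M p by exact: le_trans (normr_ge0 _) (hM p x).
exists M0, (\sum_p M p); split.
- exact: le_trans (normr_ge0 _) (hM0 0).
- by apply: sumr_ge0 => p _; exact: (M_ge0 p 0).
split => //.
- by have [] := sg [::].
- by have [] := sg [::].
- by move=> i j y; have [_] := sg [:: i]; exact.
- move=> i j y; apply: (le_trans (hM (j, i) y)).
  by rewrite (bigD1 (j, i))//= lerDl sumr_ge0// => p _; exact: (M_ge0 p 0).
Qed.

Lemma measurable_levy_integrand g x : continuous g -> measurable_fun setT (levy_integrand g x).
Proof.
move=> cg; apply: measurable_funB.
  apply: measurable_funB => //.
  apply: continuous_measurable_rV => z.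
  by apply: continuous_comp; [exact: cvgD (cvg_cst _) cvg_id|exact: cg].
apply: measurable_funM.
  apply: measurable_indic.
  rewrite (_ : [set _ | _] = enorm @^-1` `]-oo, 1]%classic).
    by rewrite -[X in measurable X]setTI; exact: measurable_enorm.
  by apply/seteqP; split => z /=; rewrite in_itv/=.
apply: measurable_sum => i; apply: measurable_funM => //; exact: measurable_coord.
Qed.

Variable nu : {measure set 'rV[R]_d -> \bar R}.
Hypothesis iW : nu.-integrable setT (EFin \o (@levy_weight R d)).

Lemma integrable_levy_integrand g x (M0 M2 : R) : 0 <= M2 -> C2_bounded g M0 M2 ->
  nu.-integrable setT (EFin \o levy_integrand g x).
Proof.
move=> M20 cg; have M00 : 0 <= M0 by exact: le_trans (normr_ge0 _) (C2b_le0 cg 0).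
apply: (@le_integrable _ _ _ nu setT measurableT _
   (fun z => (2 * M0 + d%:R ^+ 2 * M2)%:E * (levy_weight z)%:E)%E).
- by apply/measurable_EFinP; exact: measurable_levy_integrand (C2b_continuous cg).
- move=> z _; rewrite -EFinM !abse_EFin lee_fin.
  rewrite (le_trans (levy_integrand_bound x z (C2b_derivable cg) (C2b_derivable2 cg)
    (C2b_le0 cg) (C2b_le2 cg) M20))//.
  exact: ler_norm.
- exact: integrableZl.
Qed.

Lemma levy_opB g g' x (M0 M2 M0' M2' N0 N2 : R) : 0 <= M2 -> 0 <= M2' -> 0 <= N2 ->
  C2_bounded g M0 M2 -> C2_bounded g' M0' M2' ->
  (forall y, `|g y - g' y| <= N0) ->
  (forall i j y, `|partial j (partial i g) y - partial j (partial i g') y| <= N2) ->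
  `|levy_op nu g x - levy_op nu g' x| <=
    (2 * N0 + d%:R ^+ 2 * N2) * \int[nu]_z levy_weight z.
Proof.
move=> M20 M20' N20 cg cg' h0 h2; have [cB gB] := C2_boundedB cg cg' h0 h2.
have N00 : 0 <= N0 by exact: le_trans (normr_ge0 _) (h0 0).
have ig := integrable_levy_integrand x M20 cg; have ig' := integrable_levy_integrand x M20' cg'.
have iB := integrable_levy_integrand x N20 cB.
rewrite /levy_op -RintegralB//.
have BE : (fun z => levy_integrand g x z - levy_integrand g' x z) =
    levy_integrand (fun y => g y - g' y) x.
  by apply/funext => z; rewrite /levy_integrand gB dotrBr; ring.
rewrite -/(levy_integrand g x) -/(levy_integrand g' x).
rewrite -RintegralZl//.
apply: (le_trans (le_normr_Rintegral _ _)) => //; rewrite ?BE//.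
apply: le_Rintegral => //.
- by have := integrable_abse iB; rewrite -BE.
- have := integrableZl measurableT (2 * N0 + d%:R ^+ 2 * N2) iW; apply: eq_integrable => // z _.
move=> z _; rewrite -/(levy_integrand g x z) -/(levy_integrand g' x z).
rewrite (_ : _ - _ = levy_integrand (fun y => g y - g' y) x z); last by rewrite -BE.
exact: levy_integrand_bound (C2b_derivable cB) (C2b_derivable2 cB) (C2b_le0 cB) (C2b_le2 cB) N20.
Qed.

End levy_operator.

(** * The coalescing coupling *)

Section power_tangent.
Context {R : realType}.

(** Concavity of [s |-> s^be]. With the conjugate exponents [1 / be] and
    [1 / (1 - be)], it is the inequality of Young for
    [s^be * r^(1 - be) <= be s + (1 - be) r]. *)
Lemma powR_tangent (be r s : R) : 0 < be < 1 -> 0 < r -> 0 <= s ->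
  s `^ be <= r `^ be + be * r `^ (be - 1) * (s - r).
Proof.
move=> /andP[be0 be1] r0 s0.
have be1' : 0 < 1 - be by rewrite subr_gt0.
have := @conjugate_powR R (s `^ be) (r `^ (1 - be)) be^-1 (1 - be)^-1
  (powR_ge0 _ _) (powR_ge0 _ _).
rewrite !invr_gt0 !invrK -!powRrM !divff ?gt_eqF// !powRr1 ?(ltW r0)// (addrC be) subrK.
move=> /(_ be0 be1' erefl) h.
have rE : r `^ be = r `^ (be - 1) * r.
  have /(_ _)/esym := @powRD R r (be - 1) 1; rewrite subrK powRr1 ?ltW// => -> //.
  by rewrite (gt_eqF r0) implybT.
have p0 : 0 < r `^ (be - 1) by exact: powR_gt0.
have E : r `^ (1 - be) = (r `^ (be - 1))^-1 by rewrite -powRN opprB.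
move: h; rewrite E -ler_pdivlMr ?invr_gt0// invrK rE => /le_trans; apply.
by rewrite le_eqVlt; apply/orP; left; apply/eqP; ring.
Qed.

End power_tangent.

Section coalescence.
Context {R : realType} {d : nat}.
Variable nu : {measure set 'rV[R]_d -> \bar R}.
Hypothesis d_gt0 : (0 < d)%N.

Lemma enorm_cbox (w z : 'rV[R]_d) (r : R) : cbox w (r / (4 * d%:R)) z ->
  enorm (z - w) <= r / 4.
Proof.
move=> zw; have d0 : d%:R != 0 :> R by rewrite pnatr_eq0 -lt0n.
have -> : r / 4 = d%:R * (r / (4 * d%:R)) by field.
by apply: enorm_le_card => i; have := zw i; rewrite !mxE.
Qed.

(** The cubes around [(y - x) / 2] and [(x - y) / 2] used by the coupling stay
    away from the origin and inside the ball of radius [r], so the kernel is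
    at least [c1 / r^(d+1)] there. *)
Lemma enorm_midpoint_cbox (w z : 'rV[R]_d) (r : R) : enorm w = r / 2 ->
  cbox w (r / (4 * d%:R)) z -> r / 4 <= enorm z <= r.
Proof.
move=> wr /enorm_cbox zw; apply/andP; split.
  have := ler_enormD (w - z) z; rewrite subrK (enormB w z) wr; lra.
have := ler_enormD (z - w) w; rewrite subrK wr.
have := enorm_ge0 w; rewrite wr; lra.
Qed.

(** One of the jumps [z] and [z + h] falls in [N] for every [z] in the cube, so
    the cube is covered by two sets whose images in [N] have, by translation
    invariance, a total Lebesgue measure at least that of the cube. *)
Lemma coalescing_mass (c1 : R) (h : 'rV[R]_d) (N : set 'rV[R]_d) :
  levy_lower_bound c1 nu ->
  0 <= c1 -> h != 0 -> measurable N ->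
  (forall z, cbox (- (2^-1 *: h)) (enorm h / (4 * d%:R)) z -> N z \/ N (z + h)) ->
  ((c1 / (2 * (2 * d%:R) ^+ d) / enorm h)%:E <= nu N)%E.
Proof.
move=> nu_lb c10 h0 mN; have r0 : 0 < enorm h by rewrite enorm_gt0.
have hw : enorm (2^-1 *: h) = enorm h / 2 by rewrite enormZ ger0_norm// mulrC.
move: (enorm h) r0 hw => r r0 hw NN; set S := cbox _ _ in NN.
have mS : measurable S by exact: measurable_cbox.
pose P := S `&` N.
pose Q := (fun z => z - h) @^-1` S `&` N.
have mP : measurable P by exact: measurableI.
have mQ : measurable Q.
  apply: measurableI => //; rewrite -[X in measurable X]setTI.
  exact: measurable_shift.
have leP : ((c1 / r ^+ d.+1)%:E * lebesgue_rV d P <= nu N)%E.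
  apply: (@le_trans _ _ (nu P)).
    apply: nu_lb => // z [Sz _].
    have /andP[h1 h2] : r / 4 <= enorm z <= r by apply: enorm_midpoint_cbox Sz; rewrite enormN.
    by rewrite h2 andbT; apply: lt_le_trans h1; rewrite divr_gt0.
  by apply: le_measure; rewrite ?inE// => z [].
have leQ : ((c1 / r ^+ d.+1)%:E * lebesgue_rV d Q <= nu N)%E.
  apply: (@le_trans _ _ (nu Q)).
    apply: nu_lb => // z [/= Sz _].
    have /andP[h1 h2] : r / 4 <= enorm z <= r.
      apply: enorm_midpoint_cbox hw _ => i; have := Sz i; rewrite !mxE.
      by rewrite (_ : z _ i - _ - _ = z ord0 i - 2^-1 * h ord0 i)//; field.
    by rewrite h2 andbT; apply: lt_le_trans h1; rewrite divr_gt0.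
  by apply: le_measure; rewrite ?inE// => z [].
have leS : (lebesgue_rV d S <= lebesgue_rV d P + lebesgue_rV d Q)%E.
  rewrite -(lebesgue_rV_shift h mQ).
  have mQ' : measurable ((fun z => z + h) @^-1` Q).
    by rewrite -[X in measurable X]setTI; exact: measurable_shift.
  apply: (@le_trans _ _ (lebesgue_rV d (P `|` (fun z => z + h) @^-1` Q))).
    apply: le_measure; rewrite ?inE//; first exact: measurableU.
    move=> z Sz; case: (NN z Sz) => Nz; [by left|right].
    by split => //=; rewrite addrK.
  exact: measureU2.
have k0 : 0 <= c1 / r ^+ d.+1 by rewrite divr_ge0// exprn_ge0// ltW.
have : ((c1 / r ^+ d.+1)%:E * lebesgue_rV d S <= nu N + nu N)%E.
  apply: (le_trans (lee_wpmul2l _ leS)); first by rewrite lee_fin.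
  by rewrite ge0_muleDr//; exact: leeD.
rewrite lebesgue_rV_cbox; last by rewrite divr_ge0 ?mulr_ge0 ?ler0n ?(ltW r0).
rewrite -EFinM; have d0 : d%:R != 0 :> R by rewrite pnatr_eq0 -lt0n.
have -> : 2 * (r / (4 * d%:R)) = r / (2 * d%:R) by field.
have -> : c1 / r ^+ d.+1 * (r / (2 * d%:R)) ^+ d = 2 * (c1 / (2 * (2 * d%:R) ^+ d) / r).
  rewrite expr_div_n exprS; have : (2 * d%:R : R) ^+ d != 0.
    by rewrite expf_neq0// mulf_neq0.
  have : r ^+ d != 0 by rewrite expf_neq0// gt_eqF.
  move: (_ ^+ d) (_ ^+ d) => x y x0 y0.
  by field; rewrite x0 y0 gt_eqF.
case: (nu N) (measure_ge0 nu N) => [m| |]//; rewrite ?leey//.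
by rewrite -EFinD !lee_fin => _ h'; lra.
Qed.

Hypothesis iW : nu.-integrable setT (EFin \o (@levy_weight R d)).

Lemma integrable_truncation (C t : R) : 0 <= C -> 0 <= t ->
  nu.-integrable setT (EFin \o (fun z => Num.min (C * levy_weight z) t)).
Proof.
move=> C0 t0; apply: (le_integrable measurableT _ _ (integrableZl measurableT C iW)) => /=.
  apply/measurable_EFinP; apply: measurable_minr => //.
  by apply: measurable_funM => //; exact: measurable_levy_weight.
move=> z _; have CW : 0 <= C * levy_weight z by rewrite mulr_ge0// levy_weight_ge0.
rewrite lee_fin [leRHS]ger0_norm// ger0_norm; last by rewrite le_min CW.
by rewrite ge_min lexx.
Qed.

(** This turns a pointwise error [t] in the integrand into a small error in the
    integral although the Levy measure is infinite. *)
Lemma exists_small_truncation (C eta : R) : 0 <= C -> 0 < eta ->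
  exists2 t : R, 0 < t & \int[nu]_z Num.min (C * levy_weight z) t <= eta.
Proof.
move=> C0 eta0.
pose f (n : nat) (z : 'rV[R]_d) : \bar R := (Num.min (C * levy_weight z) n.+1%:R^-1)%:E.
have CW z : 0 <= C * levy_weight z by rewrite mulr_ge0// levy_weight_ge0.
have mf n : measurable_fun setT (f n).
  apply/measurable_EFinP; apply: measurable_minr => //.
  by apply: measurable_funM => //; exact: measurable_levy_weight.
have fcvg z : [set: 'rV[R]_d] z -> f n z @[n --> \oo] --> (0 : \bar R)%E.
  move=> _; apply/cvg_EFin; first by apply: nearW.
  apply: (@squeeze_cvgr _ _ _ _ (fun=> 0) (fun n => n.+1%:R^-1)).
  - apply: nearW => n /=; rewrite le_min CW invr_ge0 ler0n/=.
    by rewrite ge_min lexx orbT.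
  - exact: cvg_cst.
  - exact: cvg_harmonic.
have fg n z : [set: 'rV[R]_d] z -> (`|f n z| <= (C * levy_weight z)%:E)%E.
  move=> _; rewrite lee_fin ger0_norm; first by rewrite ge_min lexx.
  by rewrite le_min CW invr_ge0 ler0n.
have ig : nu.-integrable setT (fun z => (C * levy_weight z)%:E).
  exact: (integrableZl measurableT C iW).
have fin z : [set: 'rV[R]_d] z -> (C * levy_weight z)%:E \is a fin_num by [].
have := dominated_cvg measurableT mf fcvg fin ig fg.
rewrite integral0 => /fine_cvg /cvgrPdist_le /(_ _ eta0)[n _ /(_ n (leqnn n))].
rewrite /= sub0r normrN => h; exists n.+1%:R^-1; first by rewrite invr_gt0.
by apply: le_trans h; exact: ler_norm.
Qed.

End coalescence.

(** * Estimates at an almost maximal pair *)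

Section almost_maximum.
Context {R : realType} {d : nat}.

Lemma enorm_le_dual (v : 'rV[R]_d) (A t : R) : 0 < t -> 0 <= A ->
  (forall h, enorm h = t -> dotr h v <= A) -> enorm v <= A / t.
Proof.
move=> t0 A0 hA; have [->|v0] := eqVneq v 0; first by rewrite enorm0 divr_ge0// ltW.
have n0 : 0 < enorm v by rewrite enorm_gt0.
have := hA ((t / enorm v) *: v).
rewrite enormZ ger0_norm ?divr_ge0 ?enorm_ge0 ?(ltW t0)// divfK ?gt_eqF//.
move=> /(_ erefl); rewrite dotrZl -enorm_sqr expr2 mulrA divfK ?gt_eqF// => h.
by rewrite ler_pdivlMr// mulrC.
Qed.

Variables (g : 'rV[R]_d -> R) (M0 M2 th K be : R).
Hypothesis cg : C2_bounded g M0 M2.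
Hypothesis M2_ge0 : 0 <= M2.
Hypothesis th_gt0 : 0 < th.
Hypothesis K_gt0 : 0 < K.
Hypothesis be01 : 0 < be < 1.
Hypothesis g_le : forall x y, g x - g y <= th + K * enorm (x - y) `^ be.

Let M := M2 * d%:R ^+ 2.

Let M_ge0 : 0 <= M. Proof. by rewrite mulr_ge0// exprn_ge0. Qed.

Let taylor x h : `|g (x + h) - g x - dotr h (grad g x)| <= M * enorm h ^+ 2.
Proof.
apply: (le_trans (taylor2_partial x h (C2b_derivable cg) (C2b_derivable2 cg) (C2b_le2 cg))).
rewrite -mulrA ler_wpM2l// -exprMn lerXn2r// ?nnegrE ?mulr_ge0 ?enorm_ge0//.
  exact: sumr_ge0.
exact: sum_le_enorm.
Qed.

Let be_gt0 : 0 < be. Proof. by case/andP: be01. Qed.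

Let powS (w h : 'rV[R]_d) : w != 0 ->
  enorm (w + h) `^ be <=
  enorm w `^ be + be * enorm w `^ (be - 1) * enorm h.
Proof.
move=> w0; have r0 : 0 < enorm w by rewrite enorm_gt0.
apply: (@le_trans _ _ ((enorm w + enorm h) `^ be)).
  apply: (@ge0_ler_powR _ _ (ltW be_gt0)); rewrite ?nnegrE ?addr_ge0 ?enorm_ge0//.
  exact: ler_enormD.
have := @powR_tangent R be (enorm w) (enorm w + enorm h) be01 r0.
by rewrite addrAC subrr add0r; apply; rewrite addr_ge0 ?enorm_ge0.
Qed.

Variables (x y : 'rV[R]_d) (ep : R).
Hypothesis ep_ge0 : 0 <= ep.
Hypothesis near_max : th - ep + K * enorm (x - y) `^ be <= g x - g y.
Let slope := K * be * enorm (x - y) `^ (be - 1).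

Let addrKB (x' y' z : 'rV[R]_d) : x' + z - (y' + z) = x' - y'.
Proof. by rewrite (addrC y') addrKA. Qed.

(** Moving only [x] by [h] increases the barrier by at most [slope * |h|]. *)
Lemma almost_max_gradl (t : R) : 0 < t -> x - y != 0 ->
  enorm (grad g x) <= slope + (ep / t + M * t).
Proof.
move=> t0 xy0.
rewrite (_ : slope + _ = (slope * t + ep + M * t ^+ 2) / t); last by field; rewrite gt_eqF.
apply: enorm_le_dual => //.
  by rewrite !(addr_ge0, mulr_ge0) ?exprn_ge0 ?powR_ge0 ?(ltW t0) ?(ltW K_gt0) ?(ltW be_gt0).
move=> h ht; have := taylor x h; rewrite ler_norml ht => /andP[h1 _].
have := g_le (x + h) y; rewrite addrAC => h2.
have := ler_wpM2l (ltW K_gt0) (powS h xy0); rewrite ht mulrDr !mulrA -/slope => h3.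
have nm := near_max; lra.
Qed.

Lemma almost_max_gradr (t : R) : 0 < t -> x - y != 0 ->
  enorm (grad g y) <= slope + (ep / t + M * t).
Proof.
move=> t0 xy0.
rewrite (_ : slope + _ = (slope * t + ep + M * t ^+ 2) / t); last by field; rewrite gt_eqF.
apply: enorm_le_dual => //.
  by rewrite !(addr_ge0, mulr_ge0) ?exprn_ge0 ?powR_ge0 ?(ltW t0) ?(ltW K_gt0) ?(ltW be_gt0).
move=> h ht; have := taylor y (- h); rewrite ler_norml enormN ht dotrNl => /andP[_ h1].
have := g_le x (y - h); rewrite opprB addrA addrAC => h2.
have := ler_wpM2l (ltW K_gt0) (powS h xy0); rewrite ht mulrDr !mulrA -/slope.
move=> h3; have nm := near_max; lra.
Qed.

(** Moving both points by [h] leaves the barrier unchanged. *)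
Lemma almost_max_gradB (t : R) : 0 < t ->
  enorm (grad g x - grad g y) <= ep / t + 2 * M * t.
Proof.
move=> t0.
rewrite (_ : _ / t + _ = (ep + 2 * M * t ^+ 2) / t); last by field; rewrite gt_eqF.
apply: enorm_le_dual => //.
  by rewrite !(addr_ge0, mulr_ge0) ?exprn_ge0 ?powR_ge0 ?(ltW t0) ?(ltW K_gt0) ?(ltW be_gt0).
move=> h ht; rewrite dotrBr.
have := taylor x h; rewrite ler_norml ht => /andP[h1 _].
have := taylor y h; rewrite ler_norml ht => /andP[_ h2].
have := g_le (x + h) (y + h); have nm := near_max.
rewrite addrKB; lra.
Qed.

Let D z := levy_integrand g x z - levy_integrand g y z.
Let q := enorm (grad g x - grad g y).

Let comp_le z : `|\1_[set z : 'rV[R]_d | enorm z <= 1] z * dotr z (grad g x - grad g y)| <= q.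
Proof.
rewrite indicE; have [z1|z1] := leP (enorm z) 1; last first.
  by rewrite memNset ?mul0r ?normr0 ?enorm_ge0//= leNgt z1.
rewrite mem_set// mul1r (le_trans (CauchySchwarz_dotr _ _))//.
by rewrite -[leRHS]mul1r ler_wpM2r// enorm_ge0.
Qed.

Let DE z : D z = (g (x + z) - g (y + z)) - (g x - g y)
  - \1_[set z : 'rV[R]_d | enorm z <= 1] z * dotr z (grad g x - grad g y).
Proof. by rewrite /D /levy_integrand dotrBr; ring. Qed.

(** Both points make the same jump: the synchronous coupling. *)
Lemma almost_max_levy_integrand z : D z <= ep + q.
Proof.
rewrite DE; have := comp_le z; rewrite ler_norml => /andP[+ _].
have := g_le (x + z) (y + z); have nm := near_max; rewrite addrKB; lra.
Qed.

(** The two points meet at [x + z = y + (z + (x - y))], and the value of [g]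
    there cancels; what is left is a difference at distance [2 r]. *)
Lemma coalescing_levy_integrand z : 0 < enorm (x - y) -> 2 * ep + 2 * q <= th ->
  D z + D (z + (x - y)) <= - (K * (1 - be) * enorm (x - y) `^ be).
Proof.
move=> r0 epq; rewrite !DE.
have := comp_le z; rewrite ler_norml => /andP[+ _].
have := comp_le (z + (x - y)); rewrite ler_norml => /andP[+ _].
rewrite (_ : y + (z + (x - y)) = x + z); last by rewrite addrCA (addrC y) subrK addrC.
have := g_le (x + (z + (x - y))) (y + z).
rewrite (_ : _ - (y + z) = 2 *: (x - y)); last first.
  by apply/rowP => i; rewrite !mxE; ring.
rewrite enormZ ger0_norm//.
have := @powR_tangent R be (enorm (x - y)) (2 * enorm (x - y)) be01 r0.
rewrite (_ : be * _ * _ = be * (enorm (x - y) * enorm (x - y) `^ (be - 1))); last by ring.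
rewrite mulr_powRB1 ?(ltW r0)//.
move=> /(_ (mulr_ge0 (ler0n _ 2) (ltW r0)))/(ler_wpM2l (ltW K_gt0)) h1 h2 h3 h4.
move: near_max h1 h2 h3 h4 epq; rewrite mulrDr mulrBr mulr1.
rewrite mulrBl -!mulrA.
move: (K * _) (K * (be * _)) (K * _ ) => A A' A''.
lra.
Qed.

End almost_maximum.

Section almost_maximum_estimate.
Context {R : realType} {d : nat}.
Variable nu : {measure set 'rV[R]_d -> \bar R}.
Hypothesis d_gt0 : (0 < d)%N.
Hypothesis iW : nu.-integrable setT (EFin \o (@levy_weight R d)).
Variable c1 : R.
Hypothesis c1_ge0 : 0 <= c1.
Hypothesis nu_lb : levy_lower_bound c1 nu.

(** On the set [N] where the difference of the integrands is at most [- G], with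
    [G] half of the coalescing gain, the mass is of order [1 / r]; elsewhere the
    difference is at most a truncated weight whose integral is below [eta]. *)
Lemma almost_max_levy_op (g : 'rV[R]_d -> R) (M0 M2 th K be eta : R) :
  C2_bounded g M0 M2 -> 0 <= M2 -> 0 < th -> 0 < K -> 0 < be < 1 ->
  (forall x y, g x - g y <= th + K * enorm (x - y) `^ be) ->
  0 < eta ->
  exists2 ep : R, 0 < ep & forall x y,
    th - ep + K * enorm (x - y) `^ be <= g x - g y ->
    [/\ 0 < enorm (x - y),
      levy_op nu g x - levy_op nu g y <=
        eta - c1 / (4 * (2 * d%:R) ^+ d) * K * (1 - be) * enorm (x - y) `^ (be - 1),
      enorm (grad g x) <= K * be * enorm (x - y) `^ (be - 1) + eta &
      enorm (grad g y) <= K * be * enorm (x - y) `^ (be - 1) + eta].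
Proof.
move=> cg M20 th0 K0 be01 gle eta0.
have M00 : 0 <= M0 by exact: le_trans (normr_ge0 _) (C2b_le0 cg 0).
pose C := 2 * (2 * M0 + d%:R ^+ 2 * M2).
have C0 : 0 <= C by rewrite !(mulr_ge0, addr_ge0)// exprn_ge0.
have [t t0 ht] := exists_small_truncation iW C0 eta0.
pose M := M2 * d%:R ^+ 2.
have M_ge0 : 0 <= M by rewrite mulr_ge0// exprn_ge0.
(* With [tau] and [ep] below, the error [ep / tau + 2 M tau] on the gradients
   is at most [m]. *)
pose m := Num.min eta (Num.min t th) / 4.
have m0 : 0 < m by rewrite divr_gt0 ?ltr0n// !lt_min eta0 t0 th0.
have [meta mt mth] : [/\ 4 * m <= eta, 4 * m <= t & 4 * m <= th].
  by rewrite /m mulrC divfK//; split; rewrite !ge_min ?lexx ?orbT.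
pose tau := m / (2 * (2 * M + 1)).
have M1 : 0 < 2 * M + 1 by lra.
have tau0 : 0 < tau by rewrite divr_gt0// mulr_gt0.
have tauM : 2 * M * tau <= m / 2.
  have -> : m / 2 = (2 * M + 1) * tau by rewrite /tau; field; rewrite gt_eqF.
  by rewrite ler_wpM2r ?(ltW tau0)//; lra.
pose ep := Num.min (m / 2) (tau * (m / 2)).
have m2 : 0 < m / 2 by rewrite divr_gt0.
have ep0 : 0 < ep by rewrite lt_min m2 mulr_gt0.
have epm : ep <= m / 2 by rewrite ge_min lexx.
have eptau : ep / tau <= m / 2.
  by rewrite ler_pdivrMr// mulrC ge_min lexx orbT.
exists ep => // x y nm.
have r0 : 0 < enorm (x - y).
  rewrite enorm_gt0; apply/negP => /eqP xy0; move: nm.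
  move/eqP: xy0; rewrite subr_eq0 => /eqP ->; rewrite !subrr enorm0 powR0.
    by rewrite mulr0 addr0; lra.
  by rewrite gt_eqF//; case/andP: be01.
have xy0 : x - y != 0 by rewrite -enorm_gt0.
have Mtau : M * tau <= 2 * M * tau.
  by have : 0 <= M * tau; [rewrite mulr_ge0// ltW|lra].
have gx := almost_max_gradl cg M20 K0 be01 gle (ltW ep0) nm tau0 xy0.
have gy := almost_max_gradr cg M20 K0 be01 gle (ltW ep0) nm tau0 xy0.
have gxy := almost_max_gradB cg M20 gle (ltW ep0) nm tau0.
rewrite -/M in gx gy gxy Mtau tauM.
split => //; [|by lra|by lra].
set r := enorm (x - y) in r0 nm *.
set q := enorm (grad g x - grad g y) in gxy.
have epq : 2 * ep + 2 * q <= th by lra.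
pose D z := levy_integrand g x z - levy_integrand g y z.
pose G := K * (1 - be) * r `^ be / 2.
have be1 : 0 < 1 - be by rewrite subr_gt0; case/andP: be01.
have G0 : 0 < G by rewrite !mulr_gt0// ?powR_gt0.
pose N := [set z | D z <= - G].
have mD : measurable_fun setT D.
  by apply: measurable_funB; exact: measurable_levy_integrand (C2b_continuous cg).
have mN : measurable N.
  rewrite (_ : N = D @^-1` `]-oo, - G]%classic).
    by rewrite -[X in measurable X]setTI; exact: mD.
  by apply/seteqP; split => z /=; rewrite in_itv/=.
have massN : ((c1 / (2 * (2 * d%:R) ^+ d) / r)%:E <= nu N)%E.
  apply: coalescing_mass => // z _.
  have := coalescing_levy_integrand K0 be01 gle nm z r0 epq.
  rewrite -/(D z) -/(D (z + (x - y))) => h.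
  have [h1|h1] := leP (D z) (- G); [by left|right].
  by rewrite /N /=; move: h h1; rewrite /G -/r; lra.
have ix := integrable_levy_integrand iW x M20 cg.
have iy := integrable_levy_integrand iW y M20 cg.
have iD : nu.-integrable setT (EFin \o D).
  by have := integrableB measurableT ix iy.
have i1 : nu.-integrable setT (EFin \o (fun z => G * \1_N z)).
  apply: (le_integrable measurableT _ _ iD).
    by apply/measurable_EFinP; apply: measurable_funM => //; exact: measurable_indic.
  move=> z _ /=; rewrite lee_fin indicE; have [|_] := boolP (z \in N).
    rewrite inE /N /= => h; rewrite mulr1 gtr0_norm// -normrN.
    by rewrite ger0_norm; lra.
  by rewrite mulr0 normr0.
have it := integrable_truncation iW C0 (ltW t0).
have Dle z : D z <= Num.min (C * levy_weight z) t - G * \1_N z.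
  have CW : 0 <= C * levy_weight z by rewrite mulr_ge0// levy_weight_ge0.
  rewrite indicE; have [|_] := boolP (z \in N).
    rewrite inE /N /= mulr1 => h; apply: (le_trans h).
    by rewrite lerDr le_min CW ltW.
  rewrite mulr0 subr0 le_min; apply/andP; split.
    have b w := levy_integrand_bound w z (C2b_derivable cg) (C2b_derivable2 cg)
      (C2b_le0 cg) (C2b_le2 cg) M20.
    apply: (le_trans (ler_norm _)); apply: (le_trans (ler_normB _ _)).
    by rewrite /C -mulrA mulr_natl mulr2n lerD.
  have := almost_max_levy_integrand gle nm z; rewrite -/(D z) -/q => h; lra.
rewrite /levy_op -RintegralB//.
apply: (@le_trans _ _ (\int[nu]_z (Num.min (C * levy_weight z) t - G * \1_N z))).
  apply: le_Rintegral => //; last by move=> z _; exact: Dle.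
  by have := integrableB measurableT it i1.
rewrite RintegralB//; apply: lerB => //.
have -> : c1 / (4 * (2 * d%:R) ^+ d) * K * (1 - be) * r `^ (be - 1) =
    G * (c1 / (2 * (2 * d%:R) ^+ d) / r).
  have be0 : 0 < be by case/andP: be01.
  rewrite /G -(@mulr_powRB1 _ r be (ltW r0) be0).
  have : (2 * d%:R : R) ^+ d != 0 by rewrite expf_neq0// mulf_neq0// pnatr_eq0 -lt0n.
  by move: (_ ^+ d) => X X0; field; rewrite X0 gt_eqF.
have iN : nu.-integrable setT (EFin \o \1_N).
  have := integrableZl measurableT G^-1 i1; apply: eq_integrable => // z _.
  by rewrite /= -EFinM mulrA mulVf ?mul1r// gt_eqF.
rewrite RintegralZl//; apply: ler_wpM2l; first exact: ltW.
have := integrable_fin_num measurableT iN.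
rewrite /Rintegral integral_indic// setIT => finN.
by rewrite -lee_fin fineK.
Qed.

End almost_maximum_estimate.

(** * Regularity in time *)

Lemma measurable_I01 {R : realType} : measurable (@I01 R).
Proof. exact: measurable_itv. Qed.

Section time_regularity.
Context {R : realType} {d : nat}.
Variable nu : {measure set 'rV[R]_d -> \bar R}.
Hypothesis iW : nu.-integrable setT (EFin \o (@levy_weight R d)).
Variable u : R -> 'rV[R]_d -> R.
Hypothesis Cu : C_Cb u.

Notation mu := (@lebesgue_measure R).

Lemma near_grad t (eta : R) : I01 t -> 0 < eta ->
  \forall s \near within I01 (nbhs t), forall x, enorm (grad (u s) x - grad (u t) x) <= eta.
Proof.
move=> t01 eta0; have d1 : 0 < d%:R + 1 :> R by rewrite ltr_wpDl.
have e0 : 0 < eta / (d%:R + 1) by rewrite divr_gt0.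
have [_ uc] := Cu.
have FF : Filter (within I01 (nbhs t)) by exact: within_filter.
have := @filter_forall _ _ _ _ FF (fun i : 'I_d => uc [:: i] t _ t01 e0).
apply: filterS => s hs x.
apply: (@le_trans _ _ (d%:R * (eta / (d%:R + 1)))).
  by apply: enorm_le_card => i; have := hs i x; rewrite !mxE.
by rewrite mulrCA ler_piMr ?(ltW eta0)// ler_pdivrMr// mul1r lerDl.
Qed.

(** The operator is continuous for the supremum norms of a function and of its
    second derivatives, and these are continuous in time along [u]. *)
Lemma near_levy_op t (eta : R) : I01 t -> 0 < eta ->
  \forall s \near within I01 (nbhs t), forall x, `|levy_op nu (u s) x - levy_op nu (u t) x| <= eta.
Proof.
move=> t01 eta0.
pose IW := \int[nu]_z levy_weight z.
have IW0 : 0 <= IW by apply: Rintegral_ge0 => z _; exact: levy_weight_ge0.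
have k0 : 0 < (2 + d%:R ^+ 2) * (IW + 1) by rewrite mulr_gt0// ltr_wpDl// ?addr_ge0 ?exprn_ge0.
pose e := eta / ((2 + d%:R ^+ 2) * (IW + 1)).
have e0 : 0 < e by rewrite divr_gt0.
have [ub uc] := Cu.
have FF : Filter (within I01 (nbhs t)) by exact: within_filter.
have h2 := @filter_forall _ _ _ _ FF
  (fun p : 'I_d * 'I_d => uc [:: p.1; p.2] t _ t01 e0).
have h0 := uc [::] t _ t01 e0.
near=> s => x.
have s01 : I01 s by near: s; exact: near_withinT.
have [M0 [M2 [_ M20 cs]]] := Cb_infty_C2_bounded (ub s s01).
have [M0' [M2' [_ M20' ct]]] := Cb_infty_C2_bounded (ub t t01).
have H0 : forall y, `|u s y - u t y| <= e by near: s; exact: h0.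
have H2 : forall i j y, `|partial j (partial i (u s)) y - partial j (partial i (u t)) y| <= e.
  move=> i j; have : forall p : 'I_d * 'I_d, forall y,
    `|pderiv [:: p.1; p.2] (u s) y - pderiv [:: p.1; p.2] (u t) y| <= e by near: s.
  by move=> /(_ (j, i)).
apply: (le_trans (levy_opB iW x M20 M20' (ltW e0) cs ct H0 H2)).
rewrite -/IW -mulrDl mulrAC /e mulrCA ler_piMr ?(ltW eta0)// ler_pdivrMr// mul1r.
rewrite ler_wpM2l ?addr_ge0 ?exprn_ge0//; lra.
Unshelve. all: by end_near. Qed.

Lemma continuous_within_I01 (h : R -> R) :
  (forall t e, I01 t -> 0 < e -> \forall s \near within I01 (nbhs t), `|h s - h t| <= e) ->
  {within I01, continuous h}.
Proof.
move=> hc; apply/subspace_continuousP => t t01; apply/cvgrPdist_le => e e0.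
by apply: filterS (hc t e t01 e0) => s; rewrite distrC.
Qed.

Lemma compact_I01 : compact (@I01 R).
Proof. exact: segment_compact. Qed.

Lemma integrable_levy_op x : mu.-integrable I01 (EFin \o (fun s => levy_op nu (u s) x)).
Proof.
apply: continuous_compact_integrable; first exact: compact_I01.
apply: continuous_within_I01 => t e t01 e0.
by apply: filterS (near_levy_op t01 e0) => s.
Qed.

Lemma continuous_partial_time i x : {within I01, continuous (fun s => partial i (u s) x)}.
Proof.
apply: continuous_within_I01 => t e t01 e0.
by have [_ /(_ [:: i] t e t01 e0)] := Cu; apply: filterS => s hs; exact: (hs x).
Qed.

Lemma integrable_drift (b : R -> 'rV[R]_d -> 'rV[R]_d) (B : R) x :
  (forall i, measurable_fun I01 (fun s => b s x ord0 i)) ->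
  (forall s, I01 s -> enorm (b s x) <= B) ->
  mu.-integrable I01 (EFin \o (fun s => dotr (b s x) (grad (u s) x))).
Proof.
move=> mb bB.
have -> : EFin \o (fun s => dotr (b s x) (grad (u s) x)) =
    (fun s => \sum_(i < d) (b s x ord0 i * partial i (u s) x)%:E)%E.
  by apply/funext => s; rewrite /= sumEFin; congr EFin; apply: eq_bigr => i _; rewrite mxE.
apply: (@integrable_sum _ _ _ mu I01 measurable_I01 _ _ xpredT
  (fun (i : 'I_d) s => (b s x ord0 i * partial i (u s) x)%:E)) => i _.
have ip : mu.-integrable I01 (EFin \o (fun s => partial i (u s) x)).
  apply: continuous_compact_integrable; first exact: compact_I01.
  exact: continuous_partial_time.
have iB := @integrableZl _ _ _ mu I01 measurable_I01 B _ ip.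
apply: (@le_integrable _ _ _ mu I01 measurable_I01 _ _ _ _ iB).
  apply/measurable_EFinP; apply: measurable_funM => //.
  - exact: mb.
  - by have /measurable_EFinP := measurable_int _ ip.
move=> s s01; rewrite /= lee_fin !normrM ler_wpM2r//.
by rewrite (le_trans (coord_le_enorm _ i))// (le_trans (bB s s01))// ler_norm.
Qed.

Lemma integrable_source (h : R -> R) (F : R) : measurable_fun I01 h ->
  (forall s, I01 s -> `|h s| <= F) -> mu.-integrable I01 (EFin \o h).
Proof.
have mu1 : (mu `[0%R, 1%R]%classic < +oo)%E.
  by rewrite lebesgue_measure_itv/= lte_fin ltr01 -EFinD ltry.
move=> mh hF; apply: (@measurable_bounded_integrable _ _ _ mu h I01 measurable_I01 mu1 mh).
exists F; split; first exact: num_real.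
by move=> y Fy s s01; exact: le_trans (hF s s01) (ltW Fy).
Qed.

End time_regularity.

Section increments.
Context {R : realType}.
Notation mu := (@lebesgue_measure R).

Lemma Rintegral_increment_bounds (h : R -> R) (s t m M : R) :
  mu.-integrable I01 (EFin \o h) -> 0 <= s -> s < t -> t <= 1 ->
  (forall r, s <= r <= t -> m <= h r <= M) ->
  m * (t - s) <= \int[mu]_(r in `[0, t]) h r - \int[mu]_(r in `[0, s]) h r <= M * (t - s).
Proof.
move=> ih s0 st t1 hm.
have sub (g : R -> R) (a b : itv_bound R) : mu.-integrable I01 (EFin \o g) ->
    (BLeft 0 <= a)%O -> (b <= BRight 1)%O ->
    mu.-integrable [set` Interval a b] (EFin \o g).
  move=> ig a0 b1; apply: integrableS ig => //; first exact: measurable_I01.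
  by rewrite /I01; apply: subset_itv.
have it := sub h (BLeft 0) (BRight t) ih (lexx _) t1.
rewrite Rintegral_itvB//; last by rewrite bnd_simp ltW.
have ist := sub h (BRight s) (BRight t) ih s0 t1.
have len : fine (mu `]s, t]%classic) = t - s.
  by rewrite lebesgue_measure_itv/= lte_fin st -EFinD.
have ic k : mu.-integrable `]s, t]%classic (EFin \o cst k).
  apply: sub => //; apply: (@integrable_source _ _ `|k|) => //.
rewrite -!len -!Rintegral_cst//; apply/andP; split.
  apply: (@le_Rintegral _ _ _ mu _ (cst m) h (measurable_itv _) (ic m) ist) => r.
  by rewrite /= in_itv/= => /andP[/ltW sr rt]; have := hm r; rewrite sr rt => /(_ isT)/andP[].
apply: (@le_Rintegral _ _ _ mu _ h (cst M) (measurable_itv _) ist (ic M)) => r.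
by rewrite /= in_itv/= => /andP[/ltW sr rt]; have := hm r; rewrite sr rt => /(_ isT)/andP[].
Qed.

End increments.

(** * Comparison with the barrier *)

Section arithmetic.
Context {R : realType}.

Lemma almost_max_transfer (a a' c c' e bar bar' : R) :
  `|a' - a| <= e / 2 -> `|c' - c| <= e / 2 -> bar <= bar' -> bar' < a' - c' ->
  bar - e <= a - c.
Proof. by rewrite !ler_norml => /andP[? ?] /andP[? ?] ? ?; lra. Qed.

Lemma increment_rate_le (Lx Ly Gx Gy B F eta sl dis rb : R) : 0 <= B -> 0 <= eta ->
  Lx - Ly <= eta - dis -> Gx <= sl + eta -> Gy <= sl + eta ->
  2 * B * sl + 2 * F <= dis + 2 * F * rb ->
  (Lx + (eta + B * (Gx + eta) + F)) - (Ly - (eta + B * (Gy + eta) + F)) <=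
    (4 + 4 * B) * eta + 2 * F * rb.
Proof.
move=> B0 eta0 hL /(ler_wpM2l B0) gx /(ler_wpM2l B0) gy bal; lra.
Qed.

Lemma barrier_not_crossed (ux ux' uy uy' Ax Ay k F rb th s t : R) :
  0 < th -> s < t ->
  ux' - ux <= Ax * (t - s) -> Ay * (t - s) <= uy' - uy ->
  Ax - Ay <= th / 2 + 2 * F * rb ->
  ux - uy <= (k + 2 * F * s) * rb + th * (1 + s) ->
  ux' - uy' <= (k + 2 * F * t) * rb + th * (1 + t).
Proof.
rewrite -subr_gt0 => th0; rewrite -subr_gt0 => D0 hx hy /(ler_wpM2r (ltW D0)) hA h0.
by have := mulr_gt0 th0 D0; lra.
Qed.

End arithmetic.

Section comparison.
Context {R : realType} {d : nat}.
Hypothesis d_gt0 : (0 < d)%N.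
Variable nu : {measure set 'rV[R]_d -> \bar R}.
Hypothesis iW : nu.-integrable setT (EFin \o (@levy_weight R d)).
Variable c1 : R.
Hypothesis c1_gt0 : 0 < c1.
Hypothesis nu_lb : levy_lower_bound c1 nu.
Variables (b : R -> 'rV[R]_d -> 'rV[R]_d) (f : R -> 'rV[R]_d -> R)
  (phi : 'rV[R]_d -> R) (u : R -> 'rV[R]_d -> R) (B F : R).
Hypothesis mb : forall x i, measurable_fun I01 (fun s => b s x ord0 i).
Hypothesis mf : forall x, measurable_fun I01 (fun s => f s x).
Hypothesis b_le : forall s x, I01 s -> enorm (b s x) <= B.
Hypothesis f_le : forall s x, I01 s -> `|f s x| <= F.
Hypothesis Cu : C_Cb u.
Hypothesis uE : forall t x, I01 t ->
  u t x = phi x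
    + \int[@lebesgue_measure R]_(s in `[0, t]) levy_op nu (u s) x
    + \int[@lebesgue_measure R]_(s in `[0, t]) dotr (b s x) (grad (u s) x)
    + \int[@lebesgue_measure R]_(s in `[0, t]) f s x.

Let kappa := c1 / (4 * (2 * d%:R) ^+ d).

Variables (be K0 : R).
Hypothesis be01 : 0 < be < 1.
Hypothesis be_small : 2 * be * B + kappa / 2 <= kappa * (1 - be).
Hypothesis K0_gt0 : 0 < K0.
Hypothesis K0_large : 4 * F <= kappa * K0.
Hypothesis phi_le : forall x y, phi x - phi y <= K0 * enorm (x - y) `^ be.

Let B_ge0 : 0 <= B.
Proof.
have h : I01 (0 : R) by rewrite /I01 /= in_itv/= lexx ler01.
exact: le_trans (enorm_ge0 _) (b_le 0 h).
Qed.

Let F_ge0 : 0 <= F.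
Proof.
have h : I01 (0 : R) by rewrite /I01 /= in_itv/= lexx ler01.
exact: le_trans (normr_ge0 _) (f_le 0 h).
Qed.

Let kappa_gt0 : 0 < kappa.
Proof. by rewrite divr_gt0// mulr_gt0// exprn_gt0// mulr_gt0// ltr0n. Qed.

Let K (t : R) := K0 + 2 * F * t.

(** Drift and source are merely measurable in time, so they enter through their
    bounds only, whereas the Levy term, continuous in time, is compared with
    its frozen value [Lx]. *)
Lemma solution_increment (s t eta Lx : R) (x v : 'rV[R]_d) :
  0 <= s -> s < t -> t <= 1 ->
  (forall r, s <= r <= t -> `|levy_op nu (u r) x - Lx| <= eta) ->
  (forall r, s <= r <= t -> enorm (grad (u r) x - v) <= eta) ->
  (Lx - (eta + B * (enorm v + eta) + F)) * (t - s) <= u t x - u s x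
    <= (Lx + (eta + B * (enorm v + eta) + F)) * (t - s).
Proof.
move=> s0 st t1 hL hv.
have s1 : s <= 1 by rewrite ltW// (lt_le_trans st).
have t0 : 0 <= t by rewrite (le_trans s0)// ltW.
have I r : s <= r <= t -> I01 r.
  by move=> /andP[sr rt]; rewrite /I01 /= in_itv/= (le_trans s0)// (le_trans rt).
have tI : I01 t by apply: I; rewrite lexx ltW.
have sI : I01 s by apply: I; rewrite lexx ltW.
rewrite (uE x tI) (uE x sI).
have /andP[h1 h2] := @Rintegral_increment_bounds R _ s t (- F) F
  (integrable_source (mf x) (fun r => @f_le r x)) s0 st t1
  (fun r rst => etrans (esym (ler_norml _ _)) (f_le x (I r rst))).
have drift r : s <= r <= t ->
    - (B * (enorm v + eta)) <= dotr (b r x) (grad (u r) x) <= B * (enorm v + eta).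
  move=> rst; rewrite -ler_norml (le_trans (CauchySchwarz_dotr _ _))//.
  apply: ler_pM; rewrite ?enorm_ge0//; first exact: b_le (I _ rst).
  have := ler_enormD (grad (u r) x - v) v; rewrite subrK => /le_trans; apply.
  by rewrite addrC lerD2l; exact: hv.
have /andP[h3 h4] := Rintegral_increment_bounds
  (integrable_drift Cu (mb x) (fun r => @b_le r x)) s0 st t1 drift.
have levy r : s <= r <= t -> Lx - eta <= levy_op nu (u r) x <= Lx + eta.
  by move=> rst; have := hL r rst; rewrite ler_distl.
have /andP[h5 h6] := Rintegral_increment_bounds
  (integrable_levy_op iW Cu x) s0 st t1 levy.
apply/andP; split; lra.
Qed.

(** Gain of the coupling and growth of the barrier against drift and source;
    the source is absorbed by the former for [r <= 1] and by the latter for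
    [r >= 1]. *)
Lemma barrier_balance (r : R) (k : R) : 0 < r -> K0 <= k ->
  2 * B * (k * be * r `^ (be - 1)) + 2 * F <=
    kappa * k * (1 - be) * r `^ (be - 1) + 2 * F * r `^ be.
Proof.
move=> r0 kK0; have p0 : 0 < r `^ (be - 1) by exact: powR_gt0.
have k0 : 0 < k by exact: lt_le_trans kK0.
have q0 : 0 < r `^ be by exact: powR_gt0.
have be1 : be < 1 by case/andP: be01.
have be0 : 0 < be by case/andP: be01.
have kp : 0 <= k * r `^ (be - 1) by rewrite mulr_ge0// ltW.
have h1 := ler_wpM2r kp be_small.
suff : 2 * F <= kappa / 2 * (k * r `^ (be - 1)) + 2 * F * r `^ be by lra.
have kF : 4 * F <= kappa * k by apply: (le_trans K0_large); rewrite ler_wpM2l// ltW.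
have F0 := F_ge0; have [r1|r1] := leP r 1.
  have p1 : 1 <= r `^ (be - 1).
    rewrite -[leLHS](powRr0 r); apply: ger_powR; first by rewrite r0 r1.
    by rewrite subr_le0 (ltW be1).
  have : 0 <= F * r `^ be by rewrite mulr_ge0// ltW.
  have : kappa * k <= kappa * k * r `^ (be - 1) by rewrite ler_peMr// mulr_ge0// ltW.
  lra.
have q1 : 1 <= r `^ be by rewrite -[leLHS](powRr0 r); apply: ler_powR; rewrite ltW.
have : F <= F * r `^ be by rewrite ler_peMr.
have : 0 <= kappa * (k * r `^ (be - 1)) by rewrite mulr_ge0// ltW.
lra.
Qed.

(** The strict growth [th * t] leaves room for all the small errors. *)
Lemma barrier_comparison (th : R) : 0 < th -> forall t x y, I01 t ->
  u t x - u t y <= K t * enorm (x - y) `^ be + th * (1 + t).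
Proof.
move=> th0; apply: contrapT => /existsNP[t1' /existsNP[x1 /existsNP[y1 bad1]]].
pose bar (t : R) (x y : 'rV[R]_d) := K t * enorm (x - y) `^ be + th * (1 + t).
pose Bad := [set t | I01 t /\ exists x y, bar t x y < u t x - u t y].
have bad1' : Bad t1'.
  move: bad1 => /not_implyP[t01 /negP]; rewrite -ltNge => h.
  by split => //; exists x1, y1.
have hinf : has_inf Bad.
  split; first by exists t1'.
  by exists 0 => t [+ _]; rewrite /I01 /= in_itv/= => /andP[].
(* The first time at which the barrier is crossed, possibly not attained. *)
pose t0 := inf Bad.
have t0_ge0 : 0 <= t0.
  apply: lb_le_inf; first by exists t1'.
  by move=> t [+ _]; rewrite /I01 /= in_itv/= => /andP[].
have t0_le1 : t0 <= 1.
  apply: (le_trans (ge_inf hinf.2 bad1')).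
  by case: bad1'; rewrite /I01 /= in_itv/= => /andP[].
have t0I : I01 t0 by rewrite /I01 /= in_itv/= t0_ge0.
have before t : 0 <= t -> t < t0 -> forall x y, u t x - u t y <= bar t x y.
  move=> t_ge0 tt0 x y; rewrite leNgt; apply/negP => h.
  have : Bad t.
    split; last by exists x, y.
    by rewrite /I01 /= in_itv/= t_ge0 (le_trans (ltW tt0)).
  by move=> /(ge_inf hinf.2); rewrite leNgt tt0.
have bar_mono s t x y : s <= t -> bar s x y <= bar t x y.
  move=> st; rewrite /bar /K lerD// ?ler_wpM2r ?powR_ge0// ?lerD2l//.
  - by rewrite ler_wpM2l// mulr_ge0.
  - by rewrite ler_wpM2l ?(ltW th0)// lerD2l.
have [_ uc] := Cu.
have u_init z : u 0 z = phi z.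
  have I0 : I01 (0 : R) by rewrite /I01 /= in_itv/= lexx ler01.
  by rewrite (uE z I0) set_itv1 !Rintegral_set1 !addr0.
have at0 x y : u t0 x - u t0 y <= bar t0 x y.
  have [t00|t00] := eqVneq t0 0.
    rewrite t00 !u_init; apply: (le_trans (phi_le x y)).
    by rewrite /bar /K mulr0 !addr0 mulr1 lerDl ltW.
  rewrite leNgt; apply/negP => h.
  pose e := (u t0 x - u t0 y - bar t0 x y) / 4.
  have e0 : 0 < e by rewrite divr_gt0// subr_gt0.
  have t0p : 0 < t0 by rewrite lt_def t00.
  have := uc [::] t0 e t0I e0.
  rewrite near_withinE => /nbhs_ballP[dl /= dl0 hdl].
  pose s := Num.max 0 (t0 - dl / 2).
  have s0 : 0 <= s by rewrite le_max lexx.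
  have st0 : s < t0 by rewrite gt_max t0p ltrBlDr ltrDl divr_gt0.
  have sI : I01 s by rewrite /I01 /= in_itv/= s0 (le_trans (ltW st0)).
  have sdl : ball t0 dl s.
    rewrite /ball/= gtr0_norm ?subr_gt0//.
    have : t0 - dl / 2 <= s by rewrite le_max lexx orbT.
    have : (dl : R) / 2 < dl by rewrite ltr_pdivrMr// ltr_pMr// ltr1n.
    lra.
  have hs := hdl s sdl sI.
  have := hs x; have := hs y; rewrite /= !ler_norml => /andP[h1 h2] /andP[h3 h4].
  have := before s s0 st0 x y; have := bar_mono s t0 x y (ltW st0).
  have : 4 * e = u t0 x - u t0 y - bar t0 x y by rewrite /e mulrC divfK.
  lra.
have [M0 [M2 [_ M20 cg]]] := Cb_infty_C2_bounded (Cu.1 t0 t0I).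
have B0 := B_ge0; have F0 := F_ge0.
have B3 : 0 < 2 * (4 + 4 * B) by rewrite mulr_gt0// ltr_wpDr// mulr_ge0.
pose eta := th / (2 * (4 + 4 * B)).
have eta0 : 0 < eta by rewrite divr_gt0.
have K0K : K0 <= K t0 by rewrite lerDl !mulr_ge0.
have th0' : 0 < th * (1 + t0) by rewrite mulr_gt0// ltr_wpDr.
have gle x y : u t0 x - u t0 y <= th * (1 + t0) + K t0 * enorm (x - y) `^ be.
  by rewrite [leRHS]addrC; exact: at0.
have [ep ep0 hep] := almost_max_levy_op d_gt0 iW (ltW c1_gt0) nu_lb cg M20 th0'
  (lt_le_trans K0_gt0 K0K) be01 gle eta0.
have ep2 : 0 < ep / 2 by rewrite divr_gt0.
have : \forall s \near within I01 (nbhs t0),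
   [/\ forall x, `|u s x - u t0 x| <= ep / 2,
       forall x, `|levy_op nu (u s) x - levy_op nu (u t0) x| <= eta &
       forall x, enorm (grad (u s) x - grad (u t0) x) <= eta].
  have h1 := uc [::] t0 _ t0I ep2.
  have h2 := near_levy_op iW Cu t0I eta0.
  have h3 := near_grad Cu t0I eta0.
  near=> s; split; near: s; [exact: h1|exact: h2|exact: h3].
rewrite near_withinE => /nbhs_ballP[dl /= dl0 hdl].
have [t1 bad_t1 t1dl] := inf_adherent dl0 hinf.
have t01 : t0 <= t1 := ge_inf hinf.2 bad_t1.
case: bad_t1 => t1I [x [y hxy]].
have {}t01 : t0 < t1.
  rewrite lt_neqAle t01 andbT; apply/eqP => E; move: hxy; rewrite -E.
  by rewrite ltNge at0.
have t1_le1 : t1 <= 1 by move: t1I; rewrite /I01 /= in_itv/= => /andP[].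
have near s : t0 <= s <= t1 ->
   [/\ forall x, `|u s x - u t0 x| <= ep / 2,
       forall x, `|levy_op nu (u s) x - levy_op nu (u t0) x| <= eta &
       forall x, enorm (grad (u s) x - grad (u t0) x) <= eta].
  move=> /andP[ts st]; apply: hdl.
    rewrite /ball/= distrC ger0_norm ?subr_ge0// ltrBlDl.
    exact: le_lt_trans st t1dl.
  by rewrite /I01 /= in_itv/= (le_trans t0_ge0)// (le_trans st).
have [//|n1 _ _] := near t1 _; first by rewrite lexx ltW.
(* A crossing just after [t0] is an almost maximal pair at [t0]. *)
have nm : th * (1 + t0) - ep + K t0 * enorm (x - y) `^ be <= u t0 x - u t0 y.
  rewrite (_ : _ + _ = bar t0 x y - ep); last by rewrite /bar; ring.
  exact: almost_max_transfer (n1 x) (n1 y) (bar_mono t0 t1 x y (ltW t01)) hxy.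
have [r0 hL gx gy] := hep x y nm.
have /andP[_ ix] := solution_increment t0_ge0 t01 t1_le1
  (fun r hr => let: And3 _ h _ := near r hr in h x)
  (fun r hr => let: And3 _ _ h := near r hr in h x).
have /andP[iy _] := solution_increment t0_ge0 t01 t1_le1
  (fun r hr => let: And3 _ h _ := near r hr in h y)
  (fun r hr => let: And3 _ _ h := near r hr in h y).
have rate := increment_rate_le B0 (ltW eta0) hL gx gy (barrier_balance r0 K0K).
have etaE : (4 + 4 * B) * eta = th / 2.
  have B4 : 4 + 4 * B != 0 by rewrite gt_eqF// ltr_wpDr// mulr_ge0.
  by rewrite /eta; move: (4 + 4 * B) B4 => X X0; field.
rewrite etaE in rate.
have := barrier_not_crossed th0 t01 ix iy rate (at0 x y).
by rewrite leNgt hxy.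
Unshelve. all: by end_near. Qed.

Lemma holder_comparison t x y : I01 t ->
  u t x - u t y <= (K0 + 2 * F) * enorm (x - y) `^ be.
Proof.
move=> tI; have /andP[t0 t1] : 0 <= t <= 1 by move: tI; rewrite /I01 /= in_itv.
apply/ler_addgt0Pr => e e0.
have := barrier_comparison (divr_gt0 e0 (ltr0Sn R 1)) x y tI.
move=> /le_trans; apply; apply: lerD.
  rewrite ler_wpM2r ?powR_ge0// lerD2l ler_piMr// mulr_ge0//; exact: F_ge0.
have : 0 <= e * (1 - t) by rewrite mulr_ge0 ?subr_ge0// ltW.
lra.
Qed.

End comparison.

(** * The Holder estimate *)

Section norms.
Context {R : realType} {d : nat}.
Implicit Types g phi : 'rV[R]_d -> R.

Lemma sup_norm_ge0 g : (0 <= sup_norm g)%E.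
Proof.
apply: (@le_trans _ _ (`|g 0|%:E)); first by rewrite lee_fin.
by apply: ereal_sup_ubound; exists 0.
Qed.

Lemma sup_norm01_ge0 (f : R -> 'rV[R]_d -> R) : (0 <= sup_norm01 f)%E.
Proof.
apply: (@le_trans _ _ (`|f 0 0|%:E)); first by rewrite lee_fin.
apply: ereal_sup_ubound; exists (0, 0) => //; split => //.
by rewrite /I01 /= in_itv/= lexx ler01.
Qed.

Lemma holder_seminorm_ge0 (ga : R) g : (0 < d)%N -> (0 <= holder_seminorm ga g)%E.
Proof.
case: d g => // n g _.
pose e : 'rV[R]_n.+1 := delta_mx ord0 ord0.
have e1 : enorm e = 1.
  rewrite /enorm /dotr (bigD1 ord0)//= big1 ?addr0.
    by rewrite !mxE !eqxx mulr1 sqrtr1.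
  by move=> i i0; rewrite !mxE (negbTE i0) andbF mulr0.
apply: (@le_trans _ _ ((`|g e - g 0| / enorm (e - 0) `^ ga)%:E)).
  by rewrite lee_fin divr_ge0// powR_ge0.
apply: ereal_sup_ubound; exists (e, 0) => //=; rewrite subr0 e1; split => //.
by rewrite -enorm_gt0 e1.
Qed.

(** At distance at most one the Holder seminorm decides and lowering the
    exponent is harmless; beyond, the supremum norm suffices. *)
Lemma holder_increment phi (be ga P H : R) : 0 < be <= ga ->
  0 <= H ->
  (sup_norm phi <= P%:E)%E -> (holder_seminorm ga phi <= H%:E)%E ->
  forall x y, phi x - phi y <= (2 * P + H) * enorm (x - y) `^ be.
Proof.
move=> /andP[be0 bega] H0 hP hH x y.
have PP z : `|phi z| <= P.
  by rewrite -lee_fin (le_trans _ hP)//; apply: ereal_sup_ubound; exists z.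
have P0 : 0 <= P by exact: le_trans (normr_ge0 _) (PP 0).
have [->|xy] := eqVneq x y.
  by rewrite !subrr enorm0 powR0 ?mulr0// gt_eqF.
have r0 : 0 < enorm (x - y) by rewrite enorm_gt0 subr_eq0.
have rb0 := powR_ge0 (enorm (x - y)) be.
have [r1|r1] := leP (enorm (x - y)) 1.
  have : ((`|phi x - phi y| / enorm (x - y) `^ ga)%:E <= H%:E)%E.
    by rewrite (le_trans _ hH)//; apply: ereal_sup_ubound; exists (x, y).
  rewrite lee_fin ler_pdivrMr ?powR_gt0// => h.
  apply: (le_trans (ler_norm _)); apply: (le_trans h).
  apply: ler_pM => //; first exact: powR_ge0.
    by rewrite lerDr mulr_ge0.
  by apply: ger_powR => //; rewrite r0 r1.
have q1 : 1 <= enorm (x - y) `^ be.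
  by rewrite -[leLHS](powRr0 (enorm (x - y))); apply: ler_powR; rewrite ltW.
have h2 : 2 * P <= (2 * P + H) * enorm (x - y) `^ be.
  by rewrite -[leLHS]mulr1 ler_pM// ?mulr_ge0// lerDl.
by have := PP x; have := PP y; rewrite !ler_norml => /andP[? ?] /andP[? ?]; lra.
Qed.

End norms.

Theorem corollary6p2 (R : realType) (d : nat) (hd : (0 < d)%N)
    (c1 : R) (hc1 : 0 < c1) (gamma : R) (hgamma : 0 < gamma < 1) (B : R) :
  exists beta C : R, 0 < beta < 1 /\
  forall (c2 : R) (a : 'rV[R]_d -> R) (nu : {measure set 'rV[R]_d -> \bar R})
    (b : R -> 'rV[R]_d -> 'rV[R]_d) (f : R -> 'rV[R]_d -> R)
    (phi : 'rV[R]_d -> R) (u : R -> 'rV[R]_d -> R),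
    c1 <= c2 ->
    measurable_fun [set: 'rV[R]_d] a ->
    (forall y, c1 <= a y <= c2) ->
    (forall A, measurable A ->
      nu A = (\int[lebesgue_rV d]_(y in A) (a y / enorm y ^+ d.+1)%:E)%E) ->
    (forall (r1 r2 : R) (i : 'I_d), 0 < r1 -> r1 < r2 ->
      \int[lebesgue_rV d]_(y in [set y | r1 <= enorm y <= r2])
        (y ord0 i * a y / enorm y ^+ d.+1) = 0) ->
    (forall i : 'I_d, Linfty_Cb (fun t x => b t x ord0 i)) ->
    sup_norm01 (fun t x => enorm (b t x)) = B%:E ->
    Linfty_Cb f ->
    Cb_infty phi ->
    C_Cb u ->
    (forall t x, I01 t ->
      u t x = phi x
        + \int[@lebesgue_measure R]_(s in `[0, t]) levy_op nu (u s) x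
        + \int[@lebesgue_measure R]_(s in `[0, t]) dotr (b s x) (grad (u s) x)
        + \int[@lebesgue_measure R]_(s in `[0, t]) f s x) ->
    (ereal_sup [set holder_seminorm beta (u t) | t in I01]
      <= C%:E * (sup_norm01 f + sup_norm phi + holder_seminorm gamma phi))%E.
Proof.
have /andP[ga0 ga1] := hgamma.
have X0 : 0 < 4 * (2 * d%:R) ^+ d :> R.
  by rewrite mulr_gt0// exprn_gt0// mulr_gt0// ltr0n.
pose ka : R := c1 / (4 * (2 * d%:R) ^+ d).
have ka0 : 0 < ka by rewrite divr_gt0.
(* [be <= q] makes the drift cost at most half of the coupling gain. *)
pose q := ka / (2 * (ka + 2 * `|B|)).
have den0 : 0 < ka + 2 * `|B| by rewrite ltr_pwDl// mulr_ge0.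
have q0 : 0 < q by rewrite divr_gt0// mulr_gt0.
pose be := Num.min gamma q.
have be0 : 0 < be by rewrite lt_min ga0.
have bega : be <= gamma by rewrite ge_min lexx.
have be01 : 0 < be < 1 by rewrite be0 (le_lt_trans bega).
have beq : be * (ka + 2 * `|B|) <= ka / 2.
  apply: (@le_trans _ _ (q * (ka + 2 * `|B|))).
    by rewrite ler_wpM2r ?(ltW den0)// ge_min lexx orbT.
  by rewrite le_eqVlt; apply/orP; left; apply/eqP; rewrite /q; field; rewrite gt_eqF.
pose C := 4 / ka + 2.
have C0 : 0 < C by rewrite addr_gt0// divr_gt0.
exists be, C; split => // c2 a nu b f phi u _ ma a_bnd nuE _ hb bB hf hphi Cu uE.
have iW := integrable_levy_weight hc1 ma a_bnd nuE.
have lb := nu_lower_bound hc1 ma a_bnd nuE.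
have bBp s x : I01 s -> enorm (b s x) <= B.
  move=> s01; rewrite -lee_fin -bB; apply: ereal_sup_ubound; exists (s, x) => //=.
  by rewrite ger0_norm// enorm_ge0.
have B0 : 0 <= B by rewrite -lee_fin -bB sup_norm01_ge0.
have be_small : 2 * be * B + ka / 2 <= ka * (1 - be).
  by move: beq; rewrite ger0_norm//; lra.
have fE := sup_norm01_ge0 f; have pE := sup_norm_ge0 phi.
have hE := holder_seminorm_ge0 gamma phi hd.
have Cy : (C%:E * +oo = +oo :> \bar R)%E by rewrite gt0_muley// lte_fin.
case F_E : (sup_norm01 f) fE => [F| |]// F0; last first.
  by case: (sup_norm phi) (holder_seminorm gamma phi) pE hE => [?| |] [?| |]//= _ _;
    rewrite Cy leey.
case P_E : (sup_norm phi) pE => [P| |]// P0; last first.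
  by case: (holder_seminorm gamma phi) hE => [?| |]//= _; rewrite Cy leey.
case H_E : (holder_seminorm gamma phi) hE => [H| |]// H0; last first.
  by rewrite /= Cy leey.
rewrite !lee_fin in F0 P0 H0.
have f_le s x : I01 s -> `|f s x| <= F.
  by move=> s01; rewrite -lee_fin -F_E; apply: ereal_sup_ubound; exists (s, x).
have main t x y : I01 t -> u t x - u t y <= C * (F + P + H) * enorm (x - y) `^ be.
  move=> tI; apply/ler_addgt0Pr => e e0.
  pose r := enorm (x - y) `^ be.
  have r0 : 0 <= r by exact: powR_ge0.
  have r1 : 0 < r + 1 by lra.
  (* The barrier needs a positive height even when all the data vanish. *)
  pose e' := e / (r + 1).
  have e'0 : 0 < e' by rewrite divr_gt0.
  pose K0 := 4 / ka * F + 2 * P + H + e'.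
  have kF : 0 <= 4 / ka * F by rewrite mulr_ge0// divr_ge0// ltW.
  have K00 : 0 < K0 by rewrite ltr_pwDr// !addr_ge0// mulr_ge0.
  have K0_large : 4 * F <= ka * K0.
    have -> : 4 * F = ka * (4 / ka * F) by field; rewrite gt_eqF.
    by rewrite ler_wpM2l ?(ltW ka0)// /K0; lra.
  have phi_le x' y' : phi x' - phi y' <= K0 * enorm (x' - y') `^ be.
    have bg : 0 < be <= gamma by rewrite be0.
    have hP : (sup_norm phi <= P%:E)%E by rewrite P_E.
    have hH : (holder_seminorm gamma phi <= H%:E)%E by rewrite H_E.
    apply: (le_trans (holder_increment bg H0 hP hH x' y')).
    by rewrite ler_wpM2r ?powR_ge0// /K0; lra.
  have mb x' i : measurable_fun I01 (fun s => b s x' ord0 i) by have [+ _ _] := hb i; exact.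
  have mf x' : measurable_fun I01 (fun s => f s x') by have [+ _ _] := hf; exact.
  apply: (le_trans (holder_comparison hd iW hc1 lb mb mf bBp f_le Cu uE be01 be_small
    K00 K0_large phi_le x y tI)).
  rewrite -/r; have e'r : e' * r <= e.
    by rewrite /e' mulrAC ler_pdivrMr// ler_wpM2l ?(ltW e0)//; lra.
  have PH : 0 <= (4 / ka * (P + H) + H) * r.
    by rewrite mulr_ge0// addr_ge0// mulr_ge0 ?addr_ge0// divr_ge0// ltW.
  by rewrite /C /K0; lra.
apply: ge_ereal_sup => _ [t tI <-]; apply: ge_ereal_sup => _ [[x y] /= [xy _] <-].
have r0 : 0 < enorm (x - y) by rewrite enorm_gt0 subr_eq0.
rewrite -!EFinD -EFinM lee_fin ler_pdivrMr ?powR_gt0// ler_norml.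
rewrite main// andbT lerNl opprB enormB; exact: main.
Qed.
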